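(* Let $t,\alpha_1,\alpha_2,a$ be real numbers such that $t<-1$, $\alpha_1<\alpha_2<-\frac{(1+t)^2}{2}$ and $a<1$. For $i=1,2$ let $$\beta_i=-\frac{\alpha_i(\alpha_i+2t)}{2\alpha_i+(1+t)^2}.$$ Then $$F_D^{(3)}\!\left(2-2a;\,1-a,\,1-a,\,1-a;\,4-4a;\ \frac{2(\beta_2-\beta_1)t}{\alpha_2\beta_1-\alpha_1\beta_2},\,-\frac{2t}{\alpha_1},\,-\frac{2t}{\alpha_2}\right)=C\cdot F_D^{(3)}\!\left(1-a;\,a-\tfrac12,\,1-a,\,1-a;\,\tfrac52-2a;\ \frac{1}{t^2},\,\frac{1}{\beta_1},\,\frac{1}{\beta_2}\right),$$ where $$C=\left(\frac{t^2(\alpha_1+2t)(\alpha_2+2t)}{\alpha_1\alpha_2(1-t)^2}\right)^{a-1}.$$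
   Context: The Appell--Lauricella hypergeometric function is $$F_D^{(n)}(A;b_1,\dots,b_n;c;x_1,\dots,x_n)=\sum_{m_1,\dots,m_n\ge 0}\frac{(A)_{m_1+\cdots+m_n}(b_1)_{m_1}\cdots(b_n)_{m_n}}{(c)_{m_1+\cdots+m_n}}\frac{x_1^{m_1}\cdots x_n^{m_n}}{m_1!\cdots m_n!}$$ for $|x_i|<1$, where $(q)_m=\Gamma(q+m)/\Gamma(q)$. For $\mathrm{Re}(c)>\mathrm{Re}(A)>0$ it is analytically continued to $x_i\in\mathbb{C}\setminus[1,\infty)$ by $$F_D^{(n)}(A;b_1,\dots,b_n;c;x_1,\dots,x_n)=\frac{\Gamma(c)}{\Gamma(A)\Gamma(c-A)}\int_0^1 u^{A-1}(1-u)^{c-A-1}\prod_{i=1}^n(1-x_iu)^{-b_i}\,du,$$ with principal branches of the powers. The function values in the claim are understood in this sense. *)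

(* Defs.v *)
From HB Require Import structures.
From mathcomp Require Import all_boot all_order all_algebra.
From mathcomp Require Import complex.
From mathcomp Require Import all_classical all_reals all_analysis.

Set Implicit Arguments.
Unset Strict Implicit.
Unset Printing Implicit Defensive.
Import Order.TTheory GRing.Theory Num.Theory.
Import numFieldNormedType.Exports.

Local Open Scope classical_set_scope.
Local Open Scope ring_scope.
Local Open Scope complex_scope.

Section ComplexFunctions.
Variable R : realType.
Implicit Types z w : R[i].

Definition cmod z : R := Num.sqrt (complex.Re z ^+ 2 + complex.Im z ^+ 2).

(* Values in ]-pi, pi]; junk at z = 0. *)
Definition carg z : R :=
  let th := acos (complex.Re z / cmod z) in
  if 0 <= complex.Im z then th else - th.

Definition clog z : R[i] := ln (cmod z) +i* carg z.

Definition cexp z : R[i] :=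
  (expR (complex.Re z) * cos (complex.Im z))
    +i* (expR (complex.Re z) * sin (complex.Im z)).

(* Junk at z = 0; every base occurring in the integrands below is nonzero. *)
Definition cpow z w : R[i] := cexp (w * clog z).

Definition cintegral (D : set R) (f : R -> R[i]) : R[i] :=
  (\int[lebesgue_measure]_(u in D) complex.Re (f u))
    +i* (\int[lebesgue_measure]_(u in D) complex.Im (f u)).

(* Euler's integral, hence the Gamma function only for 0 < Re z. *)
Definition Gamma z : R[i] :=
  cintegral `]0, +oo[%classic (fun u => cpow u%:C (z - 1) * (expR (- u))%:C).

(* The analytic continuation of the Appell-Lauricella series to x_i outside
   [1, +oo[, given by its Euler integral; meaningful for 0 < Re A < Re c. *)
Definition lauricellaFD (n : nat) (A : R[i]) (b : n.-tuple R[i]) (c : R[i])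
    (x : n.-tuple R[i]) : R[i] :=
  Gamma c / (Gamma A * Gamma (c - A)) *
  cintegral `]0, 1[%classic (fun u =>
    cpow u%:C (A - 1) * cpow (1 - u%:C) (c - A - 1) *
    \prod_(i < n) cpow (1 - tnth x i * u%:C) (- tnth b i)).

End ComplexFunctions.

(* Main.v *)
Require Import Defs.
From mathcomp Require Import all_boot all_order all_algebra.
From mathcomp Require Import complex polyrcf ring lra.
From mathcomp Require Import all_classical all_reals all_analysis measurable_realfun.
Import Order.TTheory GRing.Theory Num.Theory.
Import numFieldNormedType.Exports.
Local Open Scope classical_set_scope.
Local Open Scope ring_scope.
Local Open Scope complex_scope.

(** Put s = 1 - a > 0.  Up to Gamma factors and C, the two sides are
    the integral over ]0, 1[ of L(u)^s du / (u (1 - u)), where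
    L(u) = u^2 (1 - u)^2 / ((1 - x1 u) (1 - x2 u) (1 - x3 u)), and
    the integral over ]0, 1[ of G(v)^s dv / (v sqrt ((1 - v) (1 - A v))), where
    G(v) = v (1 - v) (1 - A v) / ((1 - B1 v) (1 - B2 v)), with A = 1 / t^2 and
    B1, B2 = 1 / beta2, 1 / beta1.
    The theorem holds for every s because, with e_i = 1 - x_i and
    c = 2 sqrt (e1 e2 e3) + e1 + e2 e3, the function c L has the same
    distribution for the first density as G has for the second: for every
    eta > 0 the sets {c L > eta} and {G > eta} have the same measure.  The layer
    cake formula [layer_cake] turns this into the equality of the integrals
    ([equimeasurable_integral]).

    The equality of measures is an algebraic fact.  Put lam = c / eta.  In the
    coordinate y = u / (1 - u) the first set is defined by
    (1 + y) (1 + e1 y) (1 + e2 y) (1 + e3 y) - lam y^2 < 0, a [quartic].  In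
    a suitable homographic coordinate W of v, the second one is defined by the
    inequality [cubic] < 0, where
    (W + e1 + e2 e3) (W + e2 + e1 e3) (W + e3 + e1 e2)
      - lam (W^2 - 4 e1 e2 e3)
    is the resolvent cubic of the quartic, rescaled: changing lam moves
    a single coefficient of the quartic, and W^2 - 4 e1 e2 e3 is the
    corresponding change of the resolvent.  The quartic always has two negative
    roots - n3 and - n4; when it also has positive roots y2 < y1, the pairings
    of the roots give the roots of the cubic
    ([quartic_factor]).  With p = sqrt (e1 e2 e3), these are p (z + 1 / z) for
    z = p n3 y1 and z = p n3 y2 ([quartic_cubic_levels]).  The first density has
    the antiderivative ln y, the second one the antiderivative - ln z, and so
    the two measures, ln y1 - ln y2 and ln z1 - ln z2, agree.

    The parameters of the theorem fit because e1 = q^2 e2 e3 with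
    q = (1 + t) / (t - 1), whence p = q e2 e3 is rational.  For the Gamma
    factors, Gamma(k) Gamma(l) = B(l, k) Gamma(k + l) ([gamma_beta]) makes
    each Lauricella function a quotient of an Euler integral by a beta integral,
    and the beta integrals are related by the case e1 = e2 = e3 = 1 of the same
    transformation ([beta_integral_transform]), which is a form of the
    duplication formula. *)
Set Implicit Arguments.
Unset Strict Implicit.
Unset Printing Implicit Defensive.

Ltac positivity := do ![by []|exact: ltr01|exact: exprn_gt0|apply: divr_gt0
  |apply: addr_gt0|apply: mulr_gt0].

(** * Fundamental theorem and substitution for nonnegative integrands *)

Section calculus.
Variable R : realType.
Notation mu := (@lebesgue_measure R).
Implicit Types (f g F G : R -> R) (a b x : R).

(** The open interval is what a superlevel set is; its end points lie inside
    the domain of regularity of [F]. *)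
Lemma integral_oo_derive F f a b : a < b ->
  {in `[a, b], forall x, is_derive x 1 F (f x)} ->
  {in `[a, b], continuous f} ->
  (\int[mu]_(x in `]a, b[) (f x)%:E = (F b - F a)%:E)%E.
Proof.
move=> ab dF cf.
have cF : {in `[a, b], continuous F}.
  move=> x xab; apply/differentiable_continuous/derivable1_diffP.
  by have [] := dF _ xab.
have cw : {within `[a, b], continuous f}.
  by apply: continuous_in_subspaceT => x /[1!inE]; exact: cf.
have mf : measurable_fun `[a, b] f.
  exact: subspace_continuous_measurable_fun.
rewrite integral_itv_obnd_cbnd; last first.
  apply/measurable_EFinP; apply: measurable_funS mf => //.
  exact: subset_itv_oo_cc.
rewrite integral_itv_bndo_bndc; last first.
  apply/measurable_EFinP; apply: measurable_funS mf => //.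
  exact: subset_itv_co_cc.
rewrite (@continuous_FTC2 R f F) ?EFinB//.
  split.
  - by move=> x /subset_itv_oo_cc xab; have [] := dF x xab.
  - by apply: cvg_at_right_filter; apply: cF; rewrite in_itv/= lexx ltW.
  - by apply: cvg_at_left_filter; apply: cF; rewrite in_itv/= lexx ltW.
by move=> x /subset_itv_oo_cc xab; rewrite derive1E; have [_ ->] := dF x xab.
Qed.

(** Both sides are limits of integrals over the compact intervals of an
    exhaustion, which keep away from the possible singularities of [F] and [G] at
    the ends of [I] and [J]. *)
Lemma ge0_substitution (I J : set R) (a_ b_ : nat -> R) F f G :
  open I ->
  I = \bigcup_n `[a_ n, b_ n]%classic -> J = \bigcup_n `[F (a_ n), F (b_ n)]%classic ->
  nonincreasing_seq a_ -> nondecreasing_seq b_ -> (forall n, a_ n < b_ n) ->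
  {in I &, {homo F : x y / x < y}} ->
  {in I, forall x, is_derive x 1 F (f x)} ->
  {in I, continuous f} -> {in I, forall x, 0 <= f x} ->
  {in J, continuous G} -> {in J, forall x, 0 <= G x} ->
  (\int[mu]_(y in J) (G y)%:E = \int[mu]_(x in I) (G (F x) * f x)%:E)%E.
Proof.
move=> oI IE JE an bn ab incF dF cf f0 cG G0.
have subI n x : x \in `[a_ n, b_ n] -> x \in I.
  by move=> xab; rewrite inE IE; exists n.
have subJ n x : x \in `[F (a_ n), F (b_ n)] -> x \in J.
  by move=> xab; rewrite inE JE; exists n.
have aI n : a_ n \in I by apply: (subI n); rewrite in_itv/= lexx ltW.
have bI n : b_ n \in I by apply: (subI n); rewrite in_itv/= lexx ltW.
have leF : {in I &, {homo F : x y / x <= y}}.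
  move=> x y xI yI; rewrite !le_eqVlt => /predU1P[->|xy]; first by rewrite eqxx.
  by rewrite (incF x y)// orbT.
have cF : {in I, continuous F}.
  move=> x xI; apply/differentiable_continuous/derivable1_diffP.
  by have [] := dF _ xI.
have FJ x : x \in I -> F x \in J.
  rewrite inE [X in X x]IE => -[n _ /=]; rewrite in_itv/= => /andP[ax xb].
  have xI : x \in I by apply: (subI n); rewrite in_itv/= ax xb.
  by apply: (subJ n); rewrite in_itv/= !leF.
have cGFf : {in I, continuous (fun x => G (F x) * f x)}.
  move=> x xI; apply: continuousM; last exact: cf.
  by apply: continuous_comp; [exact: cF|apply: cG; exact: FJ].
have dFE x : x \in I -> derive1 F x = f x.
  by move=> xI; rewrite derive1E; have [_ ->] := dF x xI.
have cdF x : x \in I -> derive1 F @ x --> derive1 F x.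
  move=> xI; rewrite dFE//.
  have nI : \forall y \near x, I y.
    by apply: open_nbhs_nbhs; split=> //; move: xI; rewrite inE.
  apply: (cvg_trans _ (cf x xI)); apply: near_eq_cvg.
  by apply: filterS nI => y Iy; rewrite dFE// inE.
have part n : (\int[mu]_(y in `[F (a_ n), F (b_ n)]) (G y)%:E =
    \int[mu]_(x in `[a_ n, b_ n]) (G (F x) * f x)%:E)%E.
  rewrite (@integration_by_substitution_increasing R F G (a_ n) (b_ n)).
  - apply: eq_integral => x /[1!inE] xab /=.
    by rewrite -dFE//; exact: (subI n).
  - exact/ltW.
  - by move=> x y /subI xI /subI yI; exact: incF.
  - by move=> x /subset_itv_oo_cc /subI xI; apply: cdF.
  - by apply/cvg_ex; exists (derive1 F (a_ n)); apply: cvg_at_right_filter; exact: cdF.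
  - by apply/cvg_ex; exists (derive1 F (b_ n)); apply: cvg_at_left_filter; exact: cdF.
  - split.
    + by move=> x /subset_itv_oo_cc /subI /dF[].
    + by apply: cvg_at_right_filter; apply: cF.
    + by apply: cvg_at_left_filter; apply: cF.
  - by apply: continuous_in_subspaceT => x /[1!inE] /subJ; exact: cG.
have L : (\int[mu]_(y in `[F (a_ n), F (b_ n)]) (G y)%:E)%E @[n --> \oo] -->
    (\int[mu]_(y in J) (G y)%:E)%E.
  rewrite JE; apply: ge0_nondecreasing_set_cvg_integral => //.
  - move=> m n mn; rewrite subsetEset; apply: subset_itv.
    - by rewrite bnd_simp; apply: leF => //; exact: an.
    - by rewrite bnd_simp; apply: leF => //; exact: bn.
  - move=> n; apply/measurable_EFinP; apply: subspace_continuous_measurable_fun => //.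
    by apply: continuous_in_subspaceT => x /[1!inE] /subJ; exact: cG.
  - by move=> n x /subJ xJ; rewrite lee_fin G0.
have L' : (\int[mu]_(x in `[a_ n, b_ n]) (G (F x) * f x)%:E)%E @[n --> \oo] -->
    (\int[mu]_(x in I) (G (F x) * f x)%:E)%E; last first.
  by rewrite (funext part) in L; exact: (cvg_unique _ L L').
rewrite IE; apply: ge0_nondecreasing_set_cvg_integral => //.
- move=> m n mn; rewrite subsetEset; apply: subset_itv.
  - by rewrite bnd_simp; exact: an.
  - by rewrite bnd_simp; exact: bn.
- move=> n; apply/measurable_EFinP; apply: subspace_continuous_measurable_fun => //.
  by apply: continuous_in_subspaceT => x /[1!inE] /subI; exact: cGFf.
- by move=> n x /subI xI; rewrite lee_fin mulr_ge0// ?f0// G0// FJ.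
Qed.

End calculus.

(** * Integrals of equimeasurable functions *)

Section layer_cake.
Variable R : realType.
Notation mu := (@lebesgue_measure R).

(** Write [f x] as the length of the interval of the [y] with [0 < y < f x], and
    exchange the integrals over [x] and [y]. *)
Lemma layer_cake (D : set R) (f rho : R -> R) : measurable D ->
  measurable_fun D f -> measurable_fun D rho ->
  (forall x, D x -> 0 <= f x) -> (forall x, D x -> 0 <= rho x) ->
  (\int[mu]_(x in D) (f x * rho x)%:E =
   \int[mu]_(y in `]0%R, +oo[)
     \int[mu]_(x in D `&` [set x | (y < f x)%R]) (rho x)%:E)%E.
Proof.
move=> mD mf mrho f0 rho0.
pose f' := f \_ D; pose rho' := rho \_ D.
have mf' : measurable_fun setT f' by apply/(measurable_restrictT f mD).
have mr' : measurable_fun setT rho' by apply/(measurable_restrictT rho mD).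
have f'0 x : 0 <= f' x.
  by rewrite /f' patchE; case: ifPn => //; rewrite inE; exact: f0.
have r'0 x : 0 <= rho' x.
  by rewrite /rho' patchE; case: ifPn => //; rewrite inE; exact: rho0.
pose h (z : R * R) : \bar R :=
  (if (0 < z.2) && (z.2 < f' z.1) then rho' z.1 else 0)%:E.
have mh : measurable_fun setT h.
  apply/measurable_EFinP; apply: measurable_fun_ifT.
  - apply: measurable_and.
    + by apply: measurable_fun_ltr => //; exact: measurable_snd.
    + apply: measurable_fun_ltr; first exact: measurable_snd.
      by apply: measurableT_comp; [exact: mf'|exact: measurable_fst].
  - by apply: measurableT_comp; [exact: mr'|exact: measurable_fst].
  - exact: measurable_cst.
have h0 z : (0 <= h z)%E by rewrite /h lee_fin; case: ifP.
transitivity (\int[mu]_x \int[mu]_y h (x, y))%E.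
  rewrite integral_mkcond; apply: eq_integral => x _.
  transitivity (\int[mu]_(y in `]0%R, f' x[) (cst (rho' x)%:E y))%E.
    rewrite integral_cst//= lebesgue_measure_itv/= lte_fin.
    rewrite restrict_EFin/=.
    rewrite patchE /f' /rho' !patchE; case: ifPn => xD; last by rewrite ltxx mul0e.
    have := f0 x; rewrite inE in xD => /(_ xD).
    rewrite le_eqVlt => /predU1P[<-|fx]; first by rewrite ltxx mule0 mul0r.
    by rewrite fx sube0 -EFinM mulrC.
  rewrite [LHS]integral_mkcond; apply: eq_integral => y _.
  by rewrite /h patchE mem_setE/= in_itv/=; case: ifP.
rewrite (@fubini_tonelli _ _ _ _ R mu mu h mh h0).
rewrite [RHS]integral_mkcond; apply: eq_integral => y _.
rewrite patchE mem_setE/= in_itv/= andbT.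
case: ifPn => y0; last first.
  by apply: integral0_eq => x _; rewrite /h/= (negbTE y0).
rewrite [RHS]integral_mkcond; apply: eq_integral => x _.
rewrite /h/= y0/= /f' /rho' !patchE.
have [xD|xD] := boolP (x \in D); last first.
  rewrite if_same [in RHS]memNset//= => -[Dx _]; move: xD.
  by rewrite notin_setE.
case: ifPn => yf; first by rewrite mem_set//; split => //; move: xD; rewrite inE.
by rewrite memNset//= => -[_]; exact/negP.
Qed.

(** By the layer cake formula an integral of [f] with density [rho] depends only
    on the masses of the superlevel sets of [f]. *)
Lemma equimeasurable_integral (D : set R) (f g rho sig : R -> R) : measurable D ->
  measurable_fun D f -> measurable_fun D rho ->
  measurable_fun D g -> measurable_fun D sig ->
  (forall x, D x -> 0 <= f x) -> (forall x, D x -> 0 <= rho x) ->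
  (forall x, D x -> 0 <= g x) -> (forall x, D x -> 0 <= sig x) ->
  (forall y : R, 0 < y ->
    (\int[mu]_(x in D `&` [set x | (y < f x)%R]) (rho x)%:E =
    \int[mu]_(x in D `&` [set x | (y < g x)%R]) (sig x)%:E)%E) ->
  (\int[mu]_(x in D) (f x * rho x)%:E = \int[mu]_(x in D) (g x * sig x)%:E)%E.
Proof.
move=> mD mf mrho mg msig f0 rho0 g0 sig0 fg.
rewrite [LHS]layer_cake// [RHS]layer_cake//; apply: eq_integral => y.
by rewrite inE/= in_itv/= andbT => /fg.
Qed.

End layer_cake.

(** * A quartic and its resolvent cubic *)

Section algebra.
Variable R : realType.

(** Its product part is, up to the factor [(1 - u) ^+ 4], the product of the
    [1 - u + e_i u] at [y = u / (1 - u)], with [e_0 = 1]. *)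
Definition quartic (e1 e2 e3 lam y : R) :=
  (1 + y) * (1 + e1 * y) * (1 + e2 * y) * (1 + e3 * y) - lam * y ^+ 2.

(** The resolvent cubic of [quartic]: its roots are the products
    [- (e1 * e2 * e3) * (y_i * y_j + y_k * y_l)] for the three pairings of the
    roots of the quartic. *)
Definition cubic (e1 e2 e3 lam W : R) :=
  (W + (e1 + e2 * e3)) * (W + (e2 + e1 * e3)) * (W + (e3 + e1 * e2))
  - lam * (W ^+ 2 - 4 * (e1 * e2 * e3)).

(** The quartic equals [- lam < 0] at [-1], whereas it is positive at [0] and far
    to the left. *)
Lemma quartic_negative_roots e1 e2 e3 lam : 0 < e1 -> 0 < e2 -> 0 < e3 -> 0 < lam ->
  exists n3 n4, [/\ 0 < n4, n4 < n3,
    quartic e1 e2 e3 lam (- n3) = 0 & quartic e1 e2 e3 lam (- n4) = 0].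
Proof.
move=> e10 e20 e30 lam0.
pose q := (1 + 'X) * (1 + e1 *: 'X) * (1 + e2 *: 'X) * (1 + e3 *: 'X)
  - lam *: 'X^2 : {poly R}.
have qE y : q.[y] = quartic e1 e2 e3 lam y.
  by rewrite /q /quartic !hornerE.
have q1 : q.[-1] = - lam by rewrite qE /quartic; ring.
have q0 : q.[0] = 1 by rewrite qE /quartic; ring.
pose P := e1 * e2 * e3.
pose s1 := 1 + e1 + e2 + e3.
pose s2 := e1 + e2 + e3 + e1 * e2 + e1 * e3 + e2 * e3.
pose s3 := e1 * e2 + e1 * e3 + e2 * e3 + P.
have P0 : 0 < P by rewrite /P !mulr_gt0.
have s10 : 0 < s1 by rewrite /s1 !addr_gt0.
have s20 : 0 < s2 by rewrite /s2 !addr_gt0 ?mulr_gt0.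
have s30 : 0 < s3 by rewrite /s3 !addr_gt0 ?mulr_gt0.
(* chosen so that at [- M] the leading term beats all the negative ones *)
pose M := 1 + (s1 + lam + s3) / P.
have ss0 : 0 < s1 + lam + s3 by apply: addr_gt0 => //; exact: addr_gt0.
have M1 : 1 < M by rewrite /M ltrDl divr_gt0.
have PM : P * M = P + (s1 + lam + s3) by rewrite /M; field; rewrite gt_eqF.
have qM : 0 < q.[-M].
  rewrite qE.
  have -> : quartic e1 e2 e3 lam (- M) =
      M ^+ 3 * (P * M) - s3 * M ^+ 3 + s2 * M ^+ 2 - lam * M ^+ 2 - s1 * M + 1.
    by rewrite /quartic /s1 /s2 /s3 /P; ring.
  rewrite PM.
  have -> : M ^+ 3 * (P + (s1 + lam + s3)) - s3 * M ^+ 3 + s2 * M ^+ 2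
      - lam * M ^+ 2 - s1 * M + 1 = P * M ^+ 3 + s2 * M ^+ 2 + 1 +
      lam * M ^+ 2 * (M - 1) + s1 * M * (M - 1) * (M + 1) by ring.
  have M0 : 0 < M by rewrite (lt_trans ltr01).
  have M10 : 0 < M - 1 by rewrite subr_gt0.
  have M20 : 0 < M + 1 by rewrite addr_gt0.
  by do ![by []|exact: ltr01|exact: exprn_gt0|apply: addr_gt0|apply: mulr_gt0].
have le3 : - M <= -1 by rewrite lerN2 ltW.
have sg3 : q.[- M] * q.[-1] < 0 by rewrite q1 pmulr_rlt0// oppr_lt0.
have le4 : -1 <= 0 :> R by rewrite lerN10.
have sg4 : q.[-1] * q.[0] < 0 by rewrite q1 q0 mulr1 oppr_lt0.
have [x3 x3i /eqP r3] := poly_ivtoo le3 sg3.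
have [x4 x4i /eqP r4] := poly_ivtoo le4 sg4.
move: x3i x4i; rewrite !in_itv/= => /andP[_ x3l] /andP[x4g x4l].
exists (- x3), (- x4); rewrite !opprK -!qE; split => //.
- by rewrite oppr_gt0.
- by rewrite ltrN2 (lt_trans x3l).
Qed.

(** [S] and [T] are the sum and the product of the two remaining roots [y1] and
    [y2] of the quartic, which need not be real.  Two of the three pairings of
    its roots separate [- n3] and [- n4]; the corresponding roots of the cubic,
    [P (n3 y1 + n4 y2)] and [P (n3 y2 + n4 y1)] with [P = e1 * e2 * e3], are
    symmetric together in [y1] and [y2], so that the factor that they form is a
    quadratic polynomial with coefficients rational in [S] and [T]. *)
Lemma quartic_factor e1 e2 e3 lam n3 n4 : 0 < e1 -> 0 < e2 -> 0 < e3 ->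
  0 < n4 -> n4 < n3 ->
  quartic e1 e2 e3 lam (- n3) = 0 -> quartic e1 e2 e3 lam (- n4) = 0 ->
  exists S T, let P := e1 * e2 * e3 in
  [/\ P * n3 * n4 * T = 1,
    forall y, quartic e1 e2 e3 lam y =
      P * (y + n3) * (y + n4) * (y ^+ 2 - S * y + T) &
    forall W, cubic e1 e2 e3 lam W =
      (W + P * (T + n3 * n4)) * (W ^+ 2 - P * (n3 + n4) * S * W
         + P ^+ 2 * (n3 * n4 * (S ^+ 2 - 2 * T) + T * (n3 ^+ 2 + n4 ^+ 2)))].
Proof.
move=> e10 e20 e30 n40 n43 r3 r4.
have n30 : 0 < n3 by rewrite (lt_trans n40).
pose P := e1 * e2 * e3.
pose s1 := 1 + e1 + e2 + e3.
pose s2 := e1 + e2 + e3 + e1 * e2 + e1 * e3 + e2 * e3 - lam.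
pose s3 := e1 * e2 + e1 * e3 + e2 * e3 + P.
have P0 : 0 < P by rewrite /P !mulr_gt0.
have qE y : quartic e1 e2 e3 lam y =
    1 + s1 * y + s2 * y ^+ 2 + s3 * y ^+ 3 + P * y ^+ 4.
  by rewrite /quartic /s1 /s2 /s3 /P; ring.
have cE W : cubic e1 e2 e3 lam W =
    W ^+ 3 + s2 * W ^+ 2 + (s1 * s3 - 4 * P) * W
    + (s1 ^+ 2 * P + s3 ^+ 2 - 4 * s2 * P).
  by rewrite /cubic /s1 /s2 /s3 /P; ring.
(* the values forced by the coefficients of degrees 0 and 3 *)
pose T := (P * n3 * n4)^-1.
pose S := n3 + n4 - s3 / P.
have PT : P * n3 * n4 * T = 1.
  by rewrite /T mulfV// gt_eqF// !mulr_gt0.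
have s3E : s3 = P * (n3 + n4 - S).
  by rewrite /S; field; rewrite gt_eqF.
(* the linear and quadratic coefficients agree because both sides vanish at
   the two distinct nonzero points - n3 and - n4 *)
have s12 : s1 = P * ((n3 + n4) * T - n3 * n4 * S) /\
           s2 = P * (n3 * n4 + T - S * (n3 + n4)).
  pose A := s1 - P * ((n3 + n4) * T - n3 * n4 * S).
  pose B := s2 - P * (n3 * n4 + T - S * (n3 + n4)).
  have dE y : quartic e1 e2 e3 lam y = P * (y + n3) * (y + n4) * (y ^+ 2 - S * y + T)
      + y * (A + B * y).
    rewrite qE s3E /A /B -{1}PT; ring.
  have An3 : A - B * n3 = 0.
    have := dE (- n3); rewrite r3 addNr mulr0 !mul0r add0r => /esym/eqP.
    by rewrite mulf_eq0 oppr_eq0 gt_eqF//= mulrN => /eqP.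
  have An4 : A - B * n4 = 0.
    have := dE (- n4); rewrite r4 addNr mulr0 !mul0r add0r => /esym/eqP.
    by rewrite mulf_eq0 oppr_eq0 gt_eqF//= mulrN => /eqP.
  have : B * (n3 - n4) = 0.
    have -> : B * (n3 - n4) = (A - B * n4) - (A - B * n3) by ring.
    by rewrite An3 An4 subrr.
  have n34 : n3 - n4 != 0 by rewrite subr_eq0 gt_eqF.
  move/eqP; rewrite mulf_eq0 (negbTE n34) orbF => /eqP B0.
  move: An3; rewrite B0 mul0r subr0 => A0.
  by split; apply/eqP; rewrite -subr_eq0; apply/eqP.
case: s12 => s1E s2E.
exists S, T; split => //.
- by move=> y; rewrite -/P qE s1E s2E s3E -{1}PT; ring.
- move=> W; rewrite -/P cE.
  (* homogenise the only inhomogeneous term with [PT] *)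
  have -> : (s1 * s3 - 4 * P) = (s1 * s3 - 4 * P * (P * n3 * n4 * T)).
    by rewrite PT mulr1.
  rewrite s1E s2E s3E.
  transitivity (W ^+ 3 + P * (n3 * n4 + T - S * (n3 + n4)) * W ^+ 2 +
    (P * ((n3 + n4) * T - n3 * n4 * S) * (P * (n3 + n4 - S)) -
     4 * P * (P * n3 * n4 * T)) * W +
    ((P * ((n3 + n4) * T - n3 * n4 * S)) ^+ 2 * P +
     (P * (n3 + n4 - S)) ^+ 2 * (P * n3 * n4 * T) -
     4 * (P * (n3 * n4 + T - S * (n3 + n4))) * P * (P * n3 * n4 * T)));
    last by ring.
  by rewrite !PT; ring.
Qed.
End algebra.

Section levels.
Variable R : realType.

Lemma quadratic_ge0 (s t y : R) : s ^+ 2 <= 4 * t -> 0 <= y ^+ 2 - s * y + t.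
Proof.
move=> st; have -> : y ^+ 2 - s * y + t = (y - s / 2) ^+ 2 + (4 * t - s ^+ 2) / 4.
  by field.
by rewrite addr_ge0 ?sqr_ge0// divr_ge0// subr_ge0.
Qed.

Lemma quadratic_lt0 (y1 y2 y : R) : y2 < y1 ->
  (y ^+ 2 - (y1 + y2) * y + y1 * y2 < 0) = (y2 < y < y1).
Proof.
move=> y21; have -> : y ^+ 2 - (y1 + y2) * y + y1 * y2 = (y - y1) * (y - y2) by ring.
have [y1y|yy1] := leP y1 y.
  rewrite andbF; apply/negbTE; rewrite -leNgt mulr_ge0 ?subr_ge0//.
  by rewrite (le_trans (ltW y21)).
by rewrite andbT nmulr_rlt0 ?subr_lt0// subr_gt0.
Qed.

(** The quadratic factors of the quartic and of the cubic have discriminants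
    whose quotient is a positive square, so that both or neither of them take
    negative values.  When they do, the roots of the quartic [y1], [y2] and the
    numbers [z_i = p * n3 * y_i], which are the roots of the cubic in the
    coordinate [z] of [W = p * (z + z^-1)], have the same ratio.  That
    [1 < z2] is where the positivity of the [e_i] is used again: it means
    [n4 * y1 < n3 * y2]. *)
Lemma quartic_cubic_levels (e1 e2 e3 p lam : R) :
  0 < e1 -> 0 < e2 -> 0 < e3 -> 0 < lam -> 0 < p -> p ^+ 2 = e1 * e2 * e3 ->
  (forall y, 0 < y -> 0 <= quartic e1 e2 e3 lam y) /\
  (forall W, 2 * p < W -> 0 <= cubic e1 e2 e3 lam W) \/
  exists y1 y2 z1 z2, [/\ 0 < y2 /\ y2 < y1, 1 < z2 /\ z2 < z1,
    z1 * y2 = z2 * y1,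
    forall y, 0 < y -> (quartic e1 e2 e3 lam y < 0) = (y2 < y < y1) &
    forall W, 2 * p < W -> (cubic e1 e2 e3 lam W < 0) =
      (p * (z2 + z2^-1) < W < p * (z1 + z1^-1))].
Proof.
move=> e10 e20 e30 lam0 p0 pP.
have [n3 [n4 [n40 n43 r3 r4]]] := quartic_negative_roots e10 e20 e30 lam0.
have [S [T []]] := quartic_factor e10 e20 e30 n40 n43 r3 r4.
rewrite -pP => PT qE cE.
have n30 : 0 < n3 by rewrite (lt_trans n40).
have pn0 : 0 < p ^+ 2 * n3 * n4 by rewrite !mulr_gt0.
have T0 : 0 < T by rewrite -(pmulr_rgt0 _ pn0) PT.
have q_sg y : 0 < y -> (quartic e1 e2 e3 lam y < 0) = (y ^+ 2 - S * y + T < 0).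
  by move=> y0; rewrite qE pmulr_rlt0//; positivity.
have c_sg W : 0 < W -> (cubic e1 e2 e3 lam W < 0) =
    (W ^+ 2 - p ^+ 2 * (n3 + n4) * S * W +
      (p ^+ 2) ^+ 2 * (n3 * n4 * (S ^+ 2 - 2 * T) + T * (n3 ^+ 2 + n4 ^+ 2)) < 0).
  move=> W0; rewrite cE pmulr_rlt0//; positivity.
have W0 W : 2 * p < W -> 0 < W by apply: lt_trans; rewrite mulr_gt0.
have [ST|ST] := leP (S ^+ 2) (4 * T).
  left; split=> [y y0|W /W0 {}W0].
    by rewrite leNgt q_sg// -leNgt quadratic_ge0.
  rewrite leNgt c_sg// -leNgt quadratic_ge0// -subr_ge0.
  rewrite [leRHS](_ : _ = (p ^+ 2 * (n3 - n4)) ^+ 2 * (4 * T - S ^+ 2)); last by ring.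
  by rewrite mulr_ge0 ?sqr_ge0// subr_ge0.
have ST' : 0 < S ^+ 2 - 2 * T by rewrite subr_gt0; lra.
(* two roots of the same sign as [S]: if it is negative, there is no positive
   root on either side *)
have [S0|S0] := leP S 0.
  left; split=> [y y0|W /W0 {}W0].
    rewrite leNgt q_sg// -leNgt !addr_ge0 ?sqr_ge0 ?(ltW T0)//.
    by rewrite oppr_ge0 mulr_le0_ge0// ltW.
  rewrite leNgt c_sg// -leNgt addr_ge0//.
    rewrite addr_ge0 ?sqr_ge0// oppr_ge0 mulr_le0_ge0//; last exact: ltW.
    by rewrite mulr_ge0_le0// mulr_ge0 ?sqr_ge0// addr_ge0 ?ltW.
  by apply: ltW; positivity.
right.
pose d := Num.sqrt (S ^+ 2 - 4 * T).
have d0 : 0 < d by rewrite sqrtr_gt0 subr_gt0.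
have dE : d ^+ 2 = S ^+ 2 - 4 * T by rewrite sqr_sqrtr// subr_ge0 ltW.
have dS : d < S.
  rewrite -(@ltr_pXn2r _ 2)// ?nnegrE ?ltW// dE; lra.
pose y1 := (S + d) / 2; pose y2 := (S - d) / 2.
have y20 : 0 < y2 by rewrite /y2 divr_gt0// subr_gt0.
have y21 : y2 < y1 by rewrite /y1 /y2; lra.
have y10 : 0 < y1 by rewrite (lt_trans y20).
have SE : S = y1 + y2 by rewrite /y1 /y2; field.
have TE : T = y1 * y2.
  rewrite (_ : y1 * y2 = (S ^+ 2 - d ^+ 2) / 4); last by rewrite /y1 /y2; field.
  by rewrite dE; field.
clearbody y1 y2; subst S T.
(* the odd part of the quartic is positive at a positive root, so the quartic
   is negative at the opposite point, which lies between its negative roots *)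
have between y : 0 < y -> y ^+ 2 - (y1 + y2) * y + y1 * y2 = 0 -> n4 < y < n3.
  move=> y0 yr.
  have q0 : quartic e1 e2 e3 lam y = 0 by rewrite qE yr mulr0.
  have : quartic e1 e2 e3 lam (- y) < 0.
    rewrite -[ltRHS]q0 -subr_gt0.
    rewrite [ltRHS](_ : _ = 2 * y * (1 + e1 + e2 + e3)
      + 2 * y ^+ 3 * (e1 * e2 + e1 * e3 + e2 * e3 + e1 * e2 * e3)); last first.
      by rewrite /quartic; ring.
    by positivity.
  rewrite qE (_ : p ^+ 2 * (- y + n3) * (- y + n4) *
      ((- y) ^+ 2 - (y1 + y2) * - y + y1 * y2) =
      (p ^+ 2 * (y ^+ 2 + (y1 + y2) * y + y1 * y2)) *
      (y ^+ 2 - (n3 + n4) * y + n3 * n4)); last by ring.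
  by rewrite pmulr_rlt0 ?quadratic_lt0//; positivity.
have /andP[n4y1 n3y1] : n4 < y1 < n3 by apply: between => //; ring.
have /andP[n4y2 n3y2] : n4 < y2 < n3 by apply: between => //; ring.
have z20 : 0 < p * n3 * y2 by rewrite !mulr_gt0.
have z21 : p * n3 * y2 < p * n3 * y1 by rewrite ltr_pM2l// mulr_gt0.
(* the inverse of [z_i] involves the two other roots, as the product of all four
   is the inverse of [p ^+ 2] *)
have zV1 : (p * n3 * y1)^-1 = p * n4 * y2.
  apply: (@mulfI _ (p * n3 * y1)); first by rewrite gt_eqF// (lt_trans z20).
  rewrite mulfV; last by rewrite gt_eqF// (lt_trans z20).
  by rewrite -PT; ring.
have zV2 : (p * n3 * y2)^-1 = p * n4 * y1.
  apply: (@mulfI _ (p * n3 * y2)); first by rewrite gt_eqF.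
  by rewrite mulfV ?gt_eqF// -PT; ring.
exists y1, y2, (p * n3 * y1), (p * n3 * y2); split => //.
- split=> //; rewrite -(@ltr_pXn2r _ 2)// ?nnegrE ?(ltW z20)// expr1n -PT.
  rewrite [ltLHS](_ : _ = (p ^+ 2 * n3 * y2) * (n4 * y1)); last by ring.
  rewrite [ltRHS](_ : _ = (p ^+ 2 * n3 * y2) * (y2 * n3)); last by ring.
  by rewrite ltr_pM2l ?ltr_pM ?(ltW n40) ?(ltW y10)// !mulr_gt0.
- by ring.
- by move=> y y0; rewrite q_sg// quadratic_lt0.
- move=> W /W0 {}W0; rewrite c_sg// zV1 zV2.
  rewrite -quadratic_lt0; first by congr (_ < 0); ring.
  rewrite -subr_gt0.
  rewrite [ltRHS](_ : _ = p ^+ 2 * (n3 - n4) * (y1 - y2)); last by ring.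
  by rewrite !mulr_gt0 ?subr_gt0.
Qed.
End levels.

(** * Antiderivatives of the two densities *)

Section integrals.
Variable R : realType.
Notation mu := (@lebesgue_measure R).

Lemma is_derive_continuous (f : R -> R) (x a : R) :
  is_derive x 1 f a -> {for x, continuous f}.
Proof. by case=> df _; exact/differentiable_continuous/derivable1_diffP. Qed.

Lemma is_derive_logit (u : R) : 0 < u -> u < 1 ->
  is_derive u 1 (fun u => ln (u / (1 - u))) (u * (1 - u))^-1.
Proof.
move=> u0 u1; have v0 : 0 < 1 - u by rewrite subr_gt0.
have d1 : is_derive u 1 (fun u => 1 - u) (0 - 1).
  exact: (@is_deriveB R R R (cst 1) id u 1 0 1 _ _).
have d2 := @is_deriveV R (fun u => 1 - u) u _ 1 (lt0r_neq0 v0) d1.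
have d3 : is_derive u 1 (fun u => u / (1 - u)) _ :=
    @is_deriveM R R id _ u 1 1 _ (is_derive_id u 1) d2.
have d4 : is_derive (u / (1 - u)) 1 (@ln R) (u / (1 - u))^-1.
  by apply: is_derive1_ln; rewrite divr_gt0.
have d5 := @is_derive1_comp R (@ln R) (fun u => u / (1 - u)) u _ _ d4 d3.
apply: (is_derive_eq d5).
rewrite /= -![_ *: _]/(_ * _); field.
by rewrite !gt_eqF.
Qed.

Lemma integral_logit (y1 y2 : R) : 0 < y2 -> y2 < y1 ->
  (\int[mu]_(u in `](y2 / (1 + y2))%R, (y1 / (1 + y1))%R[) ((u * (1 - u))^-1)%:E
    = (ln y1 - ln y2)%:E)%E.
Proof.
move=> y20 y21; have y10 : 0 < y1 by rewrite (lt_trans y20).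
have u01 (y : R) : 0 < y -> 0 < y / (1 + y) /\ y / (1 + y) < 1.
  move=> y0; rewrite divr_gt0 ?ltr_pdivrMr ?mul1r ?addr_gt0//; split=> //.
  by rewrite ltrDr.
have lnE (y : R) : 0 < y -> ln (y / (1 + y) / (1 - y / (1 + y))) = ln y.
  move=> y0; congr ln; field; rewrite addrK oner_neq0/= gt_eqF//; exact: addr_gt0.
have sub u : u \in `[y2 / (1 + y2), y1 / (1 + y1)] -> 0 < u /\ u < 1.
  rewrite in_itv/= => /andP[u2 u1]; split.
    by apply: lt_le_trans u2; have [] := u01 _ y20.
  by apply: le_lt_trans u1 _; have [] := u01 _ y10.
rewrite (@integral_oo_derive R (fun u => ln (u / (1 - u)))) ?lnE//.
- rewrite ltr_pdivrMr ?addr_gt0// mulrAC ltr_pdivlMr ?addr_gt0//; nra.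
- by move=> u /sub[u0 u1]; exact: is_derive_logit.
- move=> u /sub[u0 u1].
  have nz : u * (1 - u) != 0 by rewrite mulf_neq0 ?gt_eqF// subr_gt0.
  apply: (@continuousV R R (fun u => u * (1 - u)) u nz).
  apply: (@continuousM R R id (fun u => 1 - u)); first exact: cvg_id.
  by apply: (@continuousB R R R (cst 1) id); [exact: cvg_cst|exact: cvg_id].
Qed.

Section right_density.
Variables (k p : R).
Hypotheses (k0 : 0 < k) (p0 : 0 < p).
Let c := 2 * p + k.
Let A := (k - 2 * p) / c.

Let c0 : 0 < c. Proof. by rewrite addr_gt0// mulr_gt0. Qed.

Let factor (v : R) : 0 < v -> v < 1 -> 0 < (1 - v) * (1 - A * v).
Proof.
move=> v0 v1; rewrite mulr_gt0 ?subr_gt0//.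
rewrite /A mulrAC ltr_pdivrMr// mul1r /c.
have pv := mulr_gt0 p0 v0.
have kv : k * v < k by rewrite gtr_pMr.
nra.
Qed.

(* the homography that maps ]0, 1[ onto ]2 p, +oo[ and reverses the order *)
Let W v := c / v - k.

Let WE (v : R) : v != 0 ->
  W v ^+ 2 - 4 * p ^+ 2 = (c / v) ^+ 2 * ((1 - v) * (1 - A * v)).
Proof.
move=> v0; rewrite /W /A /c; field; rewrite v0/=.
by rewrite gt_eqF.
Qed.

Let sqrtWE (v : R) : 0 < v ->
  Num.sqrt (W v ^+ 2 - 4 * p ^+ 2) = c / v * Num.sqrt ((1 - v) * (1 - A * v)).
Proof.
move=> v0; rewrite WE ?gt_eqF// sqrtrM ?sqr_ge0// sqrtr_sqr ger0_norm//.
by rewrite ltW// divr_gt0.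
Qed.

(** In the coordinate [W] the density is [- dW / sqrt (W ^+ 2 - 4 * p ^+ 2)]. *)
Lemma is_derive_right_density (v : R) : 0 < v -> v < 1 ->
  is_derive v 1 (fun v => - ln (W v + Num.sqrt (W v ^+ 2 - 4 * p ^+ 2)))
    (v * Num.sqrt ((1 - v) * (1 - A * v)))^-1.
Proof.
move=> v0 v1.
have nv0 : v != 0 by rewrite gt_eqF.
have f0 := factor v0 v1.
have rad0 : 0 < W v ^+ 2 - 4 * p ^+ 2.
  by rewrite WE// mulr_gt0// exprn_gt0// divr_gt0.
have W0 : 0 < W v.
  have kv : k * v < k by rewrite gtr_pMr.
  rewrite /W subr_gt0 ltr_pdivlMr//; apply: (lt_trans kv).
  by rewrite ltrDr mulr_gt0.
have dV := @is_deriveV R id v 1 1 nv0 (is_derive_id v 1).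
have dcV : is_derive v 1 (fun v => c / v) _ :=
  @is_deriveM R R (cst c) _ v 1 0 _ (is_derive_cst c v 1) dV.
have dW : is_derive v 1 W _ :=
  @is_deriveB R R R (fun v => c / v) (cst k) v 1 _ 0 dcV (is_derive_cst k v 1).
have dW2 : is_derive v 1 (fun v => W v ^+ 2) _ := is_deriveX 2 dW.
have dQ : is_derive v 1 (fun v => W v ^+ 2 - 4 * p ^+ 2) _ :=
  @is_deriveB R R R (fun v => W v ^+ 2) (cst (4 * p ^+ 2)) v 1 _ 0 dW2
    (is_derive_cst (4 * p ^+ 2) v 1).
have dS := @is_derive1_comp R Num.sqrt (fun v => W v ^+ 2 - 4 * p ^+ 2) v _ _
  (is_derive1_sqrt rad0) dQ.
have dT := is_deriveD dW dS.
have s0 : 0 < Num.sqrt (W v ^+ 2 - 4 * p ^+ 2) by rewrite sqrtr_gt0.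
have dL := @is_derive1_comp R (@ln R)
  (fun v => W v + Num.sqrt (W v ^+ 2 - 4 * p ^+ 2)) v _ _
  (is_derive1_ln (addr_gt0 W0 s0)) dT.
apply: (is_derive_eq (is_deriveN dL)).
have sq0 : 0 < Num.sqrt ((1 - v) * (1 - A * v)) by rewrite sqrtr_gt0.
move: s0; rewrite sqrtWE// => s0.
move: sq0 s0; set s := Num.sqrt _ => sq0 s0.
rewrite -![_ *: _]/(_ * _) expr1 /cst /=.
field; rewrite nv0 !gt_eqF//=.
have := addr_gt0 (mulr_gt0 v0 W0) (mulr_gt0 c0 sq0).
by rewrite /= mulrC.
Qed.

(** With [W = p * (z + z^-1)] and [1 < z] the antiderivative is [- ln z] up to a
    constant. *)
Lemma integral_right_density (z1 z2 : R) : 1 < z2 -> z2 < z1 ->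
  (\int[mu]_(v in `](c / (p * (z1 + z1^-1) + k))%R, (c / (p * (z2 + z2^-1) + k))%R[)
     ((v * Num.sqrt ((1 - v) * (1 - A * v)))^-1)%:E = (ln z1 - ln z2)%:E)%E.
Proof.
move=> z21 z12.
have z11 : 1 < z1 by rewrite (lt_trans z21).
have den (z : R) : 1 < z -> c < p * (z + z^-1) + k.
  move=> z1'; rewrite ltrD2r mulrC ltr_pM2l// -subr_gt0.
  have z0 : 0 < z by rewrite (lt_trans ltr01).
  rewrite [ltRHS](_ : _ = (z - 1) ^+ 2 / z); last by field; rewrite gt_eqF.
  by rewrite divr_gt0// exprn_gt0// subr_gt0.
have v01 (z : R) : 1 < z ->
    0 < c / (p * (z + z^-1) + k) /\ c / (p * (z + z^-1) + k) < 1.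
  move=> /den dz; have d0 := lt_trans c0 dz.
  by rewrite divr_gt0// ltr_pdivrMr// mul1r.
have NE (z : R) : 1 < z -> let v := c / (p * (z + z^-1) + k) in
    - ln (W v + Num.sqrt (W v ^+ 2 - 4 * p ^+ 2)) = - ln (2 * p) - ln z.
  move=> z1' v; have z0 : 0 < z by rewrite (lt_trans ltr01).
  have WvE : W v = p * (z + z^-1).
    rewrite /W /v invf_div mulrCA divff ?gt_eqF// mulr1 addrK//.
  have -> : W v ^+ 2 - 4 * p ^+ 2 = (p * (z - z^-1)) ^+ 2.
    by rewrite WvE; field; rewrite gt_eqF.
  rewrite sqrtr_sqr ger0_norm; last first.
    rewrite mulr_ge0 ?(ltW p0)// subr_ge0.
    rewrite (@le_trans _ _ 1)// ?(ltW z1')// invf_le1// ltW//.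
  rewrite WvE (_ : _ + _ = 2 * p * z); last by ring.
  by rewrite lnM ?posrE ?mulr_gt0// opprD.
have lt12 : c / (p * (z1 + z1^-1) + k) < c / (p * (z2 + z2^-1) + k).
  rewrite ltr_pM2l// ltf_pV2 ?posrE ?(lt_trans c0 (den _ _))//.
  rewrite ltrD2r ltr_pM2l// -subr_gt0.
  have z10 : 0 < z1 by rewrite (lt_trans ltr01).
  have z20 : 0 < z2 by rewrite (lt_trans ltr01).
  rewrite [ltRHS](_ : _ = (z1 - z2) * (z1 * z2 - 1) / (z1 * z2)); last first.
    by field; rewrite !gt_eqF.
  rewrite divr_gt0 ?mulr_gt0 ?subr_gt0//.
  by rewrite -[ltLHS]mulr1 ltr_pM.
have sub v : v \in `[c / (p * (z1 + z1^-1) + k), c / (p * (z2 + z2^-1) + k)] ->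
    0 < v /\ v < 1.
  rewrite in_itv/= => /andP[v1 v2]; split.
    by apply: lt_le_trans v1; have [] := v01 _ z11.
  by apply: le_lt_trans v2 _; have [] := v01 _ z21.
rewrite (@integral_oo_derive R
  (fun v => - ln (W v + Num.sqrt (W v ^+ 2 - 4 * p ^+ 2)))) ?NE//.
- by congr EFin; ring.
- by move=> v /sub[v0 v1]; exact: is_derive_right_density.
- move=> v /sub[v0 v1].
  have nz : v * Num.sqrt ((1 - v) * (1 - A * v)) != 0.
    by rewrite mulf_neq0 ?gt_eqF ?sqrtr_gt0 ?factor.
  apply: (@continuousV R R (fun v => v * Num.sqrt ((1 - v) * (1 - A * v))) v nz).
  apply: (@continuousM R R id); first exact: cvg_id.
  have cf : {for v, continuous (fun v : R => (1 - v) * (1 - A * v))}.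
    apply: (@continuousM R R (fun v => 1 - v) (fun v => 1 - A * v)).
      by apply: (@continuousB R R R (cst 1) id); [exact: cvg_cst|exact: cvg_id].
    apply: (@continuousB R R R (cst 1) (fun v => A * v)); first exact: cvg_cst.
    by apply: (@continuousM R R (cst A) id); [exact: cvg_cst|exact: cvg_id].
  exact: (@continuous_comp R R R _ Num.sqrt v cf (@sqrt_continuous R _)).
Qed.
End right_density.
End integrals.

(** * The transformation of the integrals *)

Section transformation.
Variable R : realType.
Notation mu := (@lebesgue_measure R).

Lemma lt_powR_inv (s x y : R) : 0 < s -> 0 <= x -> 0 < y ->
  (y < x `^ s) = (y `^ s^-1 < x).
Proof.
move=> s0 x0 y0.
have yE : (y `^ s^-1) `^ s = y.
  by rewrite -powRrM mulVf ?gt_eqF// powRr1 ?ltW.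
rewrite -{1}yE; apply/idP/idP => h; last first.
  by apply: gt0_ltr_powR => //; rewrite nnegrE ?powR_ge0.
rewrite ltNge; apply/negP => h'.
move: h; rewrite ltNge => /negP; apply.
by apply: ge0_ler_powR => //; rewrite ?nnegrE ?powR_ge0// ltW.
Qed.

Lemma measurable_invr : measurable_fun [set: R] (@GRing.inv R).
Proof.
have -> : (@GRing.inv R) = fun x => if 0 <= x then x `^ (-1) else - (- x) `^ (-1).
  apply/funext => x; case: ifPn => x0; first by rewrite powR_inv1.
  by rewrite powR_inv1 ?invrN ?opprK// oppr_ge0 ltW// ltNge.
apply: measurable_fun_ifT.
- by apply: measurable_fun_ler => //; exact: measurable_cst.
- exact: measurable_powR.
- apply: measurableT_comp => //.
  by apply: (measurableT_comp (measurable_powR (-1))); exact: measurable_funN.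
Qed.

Ltac measurability := do ![exact: measurable_cst|exact: measurable_id
  |exact: oppr_measurable|apply: measurable_funN|apply: measurable_funB
  |apply: measurable_funD|apply: measurable_funM
  |apply: measurable_funX|apply: (measurableT_comp measurable_invr)].

Section superlevel_sets.
Variables (e1 e2 e3 p : R).
Hypotheses (e10 : 0 < e1) (e20 : 0 < e2) (e30 : 0 < e3) (p0 : 0 < p).
Hypothesis pP : p ^+ 2 = e1 * e2 * e3.
Let k0 := e1 + e2 * e3.
Let k1 := e2 + e1 * e3.
Let k2 := e3 + e1 * e2.
Let c := 2 * p + k0.
Let A := (k0 - 2 * p) / c.
Let B1 := (k0 - k1) / c.
Let B2 := (k0 - k2) / c.

Let f u := c * (u ^+ 2 * (1 - u) ^+ 2 /
  ((1 - u + e1 * u) * (1 - u + e2 * u) * (1 - u + e3 * u))).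
Let g v := v * (1 - v) * (1 - A * v) / ((1 - B1 * v) * (1 - B2 * v)).

Let k00 : 0 < k0. Proof. by rewrite /k0; positivity. Qed.
Let c0 : 0 < c. Proof. by rewrite /c; apply: addr_gt0 => //; positivity. Qed.

Let f_gt0 u : 0 < u -> u < 1 -> 0 < f u.
Proof. by move=> u0; rewrite -subr_gt0 => u1; rewrite /f; positivity. Qed.

Let den v : 0 < v -> v < 1 -> 0 < c / v - k0 - 2 * p.
Proof.
move=> v0 v1; rewrite (_ : _ - _ = c / v - c); last by rewrite /c; ring.
by rewrite subr_gt0 ltr_pdivlMr// gtr_pMr.
Qed.

(* the homographic change of variable [W = c / v - k0] turns [g] into a ratio
   of polynomials in [W] *)
Let gE v : 0 < v -> v < 1 -> g v = c * ((c / v - k0) ^+ 2 - 4 * p ^+ 2) /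
  ((c / v - k0 + k0) * (c / v - k0 + k1) * (c / v - k0 + k2)).
Proof.
move=> v0 v1; have := den v0 v1; set W := c / v - k0 => W0.
have WE : c = v * (W + k0) by rewrite /W subrK mulrC divfK// gt_eqF.
have W2p : 0 < W by have := p0; lra.
have nz (k : R) : 0 < k -> W + k != 0 by move=> k_gt0; rewrite gt_eqF// addr_gt0.
have k10 : 0 < k1 by rewrite /k1; positivity.
have k20 : 0 < k2 by rewrite /k2; positivity.
have E0 : 1 - v = v * (W - 2 * p) / c.
  apply: (@mulIf _ c); rewrite ?gt_eqF// divfK ?gt_eqF//.
  by rewrite mulrBl mul1r {1}WE /c; ring.
have EA : 1 - A * v = v * (W + 2 * p) / c.
  apply: (@mulIf _ c); rewrite ?gt_eqF// divfK ?gt_eqF//.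
  by rewrite mulrBl mul1r /A mulrAC divfK ?gt_eqF// {1}WE; ring.
have EB k : 1 - (k0 - k) / c * v = v * (W + k) / c.
  apply: (@mulIf _ c); rewrite ?gt_eqF// divfK ?gt_eqF//.
  by rewrite mulrBl mul1r mulrAC divfK ?gt_eqF// {1}WE; ring.
rewrite /g E0 EA /B1 /B2 !EB; clearbody W.
rewrite WE; field.
by rewrite !nz//= gt_eqF.
Qed.

Let g_gt0 v : 0 < v -> v < 1 -> 0 < g v.
Proof.
move=> v0 v1; rewrite gE//; have := den v0 v1.
set W := c / v - k0 => W2p.
have W0 : 0 < W by have := p0; lra.
have -> : W ^+ 2 - 4 * p ^+ 2 = (W - 2 * p) * (W + 2 * p) by ring.
have k10 : 0 < k1 by rewrite /k1; positivity.
have k20 : 0 < k2 by rewrite /k2; positivity.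
clearbody W; positivity.
Qed.

(* [quartic] is [eta - f u] times a positive factor; likewise for [g] below *)
Let f_level eta u : 0 < eta -> 0 < u -> u < 1 ->
  (eta < f u) = (quartic e1 e2 e3 (c / eta) (u / (1 - u)) < 0).
Proof.
move=> eta0 u0; rewrite -subr_gt0 => u1.
have d0 : 0 < (1 - u + e1 * u) * (1 - u + e2 * u) * (1 - u + e3 * u) by positivity.
have -> : quartic e1 e2 e3 (c / eta) (u / (1 - u)) =
    (eta - f u) * ((1 - u + e1 * u) * (1 - u + e2 * u) * (1 - u + e3 * u)
       / (eta * (1 - u) ^+ 4)).
  rewrite /quartic /f; clearbody c; field.
  by rewrite !gt_eqF//=; positivity.
by rewrite pmulr_llt0 ?subr_lt0//; positivity.
Qed.

Let g_level eta v : 0 < eta -> 0 < v -> v < 1 ->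
  (eta < g v) = (cubic e1 e2 e3 (c / eta) (c / v - k0) < 0).
Proof.
move=> eta0 v0 v1; rewrite gE//; have := den v0 v1.
set W := c / v - k0 => W2p.
have W0 : 0 < W by have := p0; lra.
have k10 : 0 < k1 by rewrite /k1; positivity.
have k20 : 0 < k2 by rewrite /k2; positivity.
have d0 : 0 < (W + k0) * (W + k1) * (W + k2) by clearbody W; positivity.
have -> : cubic e1 e2 e3 (c / eta) W =
    (eta - c * (W ^+ 2 - 4 * p ^+ 2) / ((W + k0) * (W + k1) * (W + k2))) *
    ((W + k0) * (W + k1) * (W + k2) / eta).
  rewrite /cubic -/k0 -/k1 -/k2 -pP; clearbody W c k0 k1 k2; field.
  by rewrite !gt_eqF//=; positivity.
by rewrite pmulr_llt0 ?subr_lt0//; positivity.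
Qed.

Let D := [set` `]0, 1[] : set R.

Let sig v := (v * Num.sqrt ((1 - v) * (1 - A * v)))^-1.

(** Both superlevel sets are empty, or both are intervals whose end points are the
    images of the roots of the quartic and of the cubic, where the logarithmic
    antiderivatives take the values [ln y1], [ln y2] and [ln z1], [ln z2]. *)
Let level_measure eta : 0 < eta ->
  (\int[mu]_(u in D `&` [set u | (eta < f u)%R]) ((u * (1 - u))^-1)%:E =
   \int[mu]_(v in D `&` [set v | (eta < g v)%R]) (sig v)%:E)%E.
Proof.
move=> eta0; have lam0 : 0 < c / eta by rewrite divr_gt0.
have DE x : D x = (0 < x < 1) :> Prop by rewrite /D /= in_itv.
have [[fe ge]|[y1 [y2 [z1 [z2 [[y20 y21] [z20 z21] zy fl gl]]]]]] :=
    quartic_cubic_levels e10 e20 e30 lam0 p0 pP.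
  rewrite (_ : D `&` _ = set0); last first.
    apply/seteqP; split=> // u [/=]; rewrite DE => /andP[u0 u1].
    rewrite f_level// ltNge => /negP; apply; apply: fe.
    by rewrite divr_gt0// subr_gt0.
  rewrite (_ : D `&` _ = set0) ?integral_set0//.
  apply/seteqP; split=> // v [/=]; rewrite DE => /andP[v0 v1].
  rewrite g_level// ltNge => /negP; apply; apply: ge.
  by rewrite -subr_gt0; exact: den.
have y10 : 0 < y1 by exact: lt_trans y21.
have z10 : 0 < z1 by rewrite (lt_trans _ z21)// (lt_trans ltr01).
have z20' : 0 < z2 by rewrite (lt_trans ltr01).
have -> : D `&` [set u | eta < f u] = `]y2 / (1 + y2), y1 / (1 + y1)[%classic.
  have lo (u y : R) : u < 1 -> 0 < y -> (y < u / (1 - u)) = (y / (1 + y) < u).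
    move=> u1 y0; rewrite ltr_pdivlMr ?subr_gt0// ltr_pdivrMr ?addr_gt0//.
    by apply/idP/idP; nra.
  have hi (u y : R) : u < 1 -> 0 < y -> (u / (1 - u) < y) = (u < y / (1 + y)).
    move=> u1 y0; rewrite ltr_pdivrMr ?subr_gt0// ltr_pdivlMr ?addr_gt0//.
    by apply/idP/idP; nra.
  apply/seteqP; split=> u /=.
    rewrite DE => -[/andP[u0 u1]]; rewrite f_level// fl ?divr_gt0 ?subr_gt0//.
    by rewrite lo// hi// in_itv.
  rewrite in_itv/= DE => /andP[u2 u1].
  have u0 : 0 < u by apply: lt_trans u2; rewrite divr_gt0// addr_gt0.
  have u1' : u < 1.
    by apply: (lt_trans u1); rewrite ltr_pdivrMr ?addr_gt0// mul1r ltrDr.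
  rewrite u0 u1'; split=> //; rewrite f_level// fl ?divr_gt0 ?subr_gt0//.
  by rewrite lo// hi// u2 u1.
have -> : D `&` [set v | eta < g v] =
    `](c / (p * (z1 + z1^-1) + k0)), (c / (p * (z2 + z2^-1) + k0))[%classic.
  have W0 (z : R) : 0 < z -> 0 < p * (z + z^-1) + k0.
    by move=> z_gt0; rewrite addr_gt0// mulr_gt0// addr_gt0// invr_gt0.
  have lo (v w : R) : 0 < v -> 0 < w + k0 -> (w < c / v - k0) = (v < c / (w + k0)).
    by move=> v0 w0; rewrite ltrBrDr ltr_pdivlMr// ltr_pdivlMr// mulrC.
  have hi (v w : R) : 0 < v -> 0 < w + k0 -> (c / v - k0 < w) = (c / (w + k0) < v).
    by move=> v0 w0; rewrite ltrBlDr ltr_pdivrMr// ltr_pdivrMr// mulrC.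
  apply/seteqP; split=> v /=.
    rewrite DE => -[/andP[v0 v1]]; rewrite g_level// gl; last first.
      by rewrite -subr_gt0; exact: den.
    by rewrite lo ?W0// hi ?W0// in_itv/= => /andP[-> ->].
  rewrite in_itv/= DE => /andP[v1 v2].
  have v0 : 0 < v by apply: lt_trans v1; rewrite divr_gt0// W0.
  have v1' : v < 1.
    apply: (lt_trans v2); rewrite ltr_pdivrMr ?W0// mul1r ltrD2r mulrC.
    rewrite ltr_pM2l// -subr_gt0.
    rewrite [ltRHS](_ : _ = (z2 - 1) ^+ 2 / z2); last by field; rewrite gt_eqF.
    by rewrite divr_gt0// exprn_gt0// subr_gt0.
  rewrite v0 v1'; split=> //; rewrite g_level// gl; last first.
    by rewrite -subr_gt0; exact: den.
  by rewrite lo ?W0// hi ?W0// v1 v2.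
rewrite integral_logit// integral_right_density//; congr EFin.
rewrite -!ln_div ?posrE//; congr ln.
apply/eqP; rewrite (eqr_div _ _ (lt0r_neq0 y20) (lt0r_neq0 z20')) zy.
by rewrite mulrC.
Qed.

(** Raising to the power [s] reparametrises the levels, so that [f `^ s] and
    [g `^ s] inherit the equality of [level_measure]. *)
Lemma lauricella_integral_transform s : 0 < s ->
  (\int[mu]_(u in D) ((f u) `^ s * (u * (1 - u))^-1)%:E =
   \int[mu]_(v in D) ((g v) `^ s * sig v)%:E)%E.
Proof.
move=> s0.
have DE x : D x = (0 < x < 1) :> Prop by rewrite /D /= in_itv.
apply: equimeasurable_integral.
- exact: measurable_itv.
- apply: measurable_funTS; apply: (measurableT_comp (measurable_powR s)).
  by rewrite /f; measurability.
- by apply: measurable_funTS; measurability.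
- apply: measurable_funTS; apply: (measurableT_comp (measurable_powR s)).
  by rewrite /g; measurability.
- apply: measurable_funTS; rewrite /sig.
  apply: (measurableT_comp measurable_invr).
  apply: measurable_funM; first exact: measurable_id.
  apply: (measurableT_comp (continuous_measurable_fun (@sqrt_continuous R))).
  by measurability.
- by move=> x _; exact: powR_ge0.
- move=> u; rewrite DE => /andP[u0 u1].
  by rewrite invr_ge0 mulr_ge0 ?subr_ge0 ?ltW.
- by move=> x _; exact: powR_ge0.
- move=> v; rewrite DE => /andP[v0 v1].
  by rewrite invr_ge0 mulr_ge0 ?sqrtr_ge0 ?ltW.
move=> y y0; have y0' : 0 < y `^ s^-1 by exact: powR_gt0.
rewrite -(_ : D `&` [set u | y `^ s^-1 < f u] = D `&` [set u | y < f u `^ s]).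
  rewrite -(_ : D `&` [set u | y `^ s^-1 < g u] = D `&` [set u | y < g u `^ s]).
    exact: level_measure.
  apply/seteqP; split=> v /= [] /[dup] Dv; rewrite DE => /andP[v0 v1];
    by rewrite lt_powR_inv//; apply/ltW/g_gt0.
apply/seteqP; split=> u /= [] /[dup] Du; rewrite DE => /andP[u0 u1];
  by rewrite lt_powR_inv//; apply/ltW/f_gt0.
Qed.

End superlevel_sets.
End transformation.

(** * Gamma and beta integrals *)

Section changes_of_variables.
Variable R : realType.
Notation mu := (@lebesgue_measure R).

Lemma tonelli_itv (D1 D2 : set R) (h : R -> R -> R) :
  measurable D1 -> measurable D2 ->
  measurable_fun [set: R * R] (fun z => h z.1 z.2) ->
  (forall x y, 0 <= h x y) ->
  (\int[mu]_(x in D1) \int[mu]_(y in D2) (h x y)%:E =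
   \int[mu]_(y in D2) \int[mu]_(x in D1) (h x y)%:E)%E.
Proof.
move=> mD1 mD2 mh h0.
pose h' := fun z : R * R => (h z.1 z.2 * (\1_D1 z.1 * \1_D2 z.2))%:E.
have mh' : measurable_fun setT h'.
  apply/measurable_EFinP; apply: measurable_funM => //.
  by apply: measurable_funM; [apply: (measurableT_comp _ measurable_fst)
    |apply: (measurableT_comp _ measurable_snd)]; exact: measurable_indic.
have h'0 z : (0 <= h' z)%E by rewrite lee_fin !mulr_ge0.
transitivity (\int[mu]_x \int[mu]_y h' (x, y))%E.
  rewrite integral_mkcond; apply: eq_integral => x _; rewrite patchE.
  case: ifPn => xD; last first.
    by rewrite integral0_eq// => y _; rewrite /h'/= indicE (negbTE xD) mul0r mulr0.
  rewrite integral_mkcond; apply: eq_integral => y _; rewrite patchE.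
  by rewrite /h'/= !indicE xD mul1r; case: ifPn => yD; rewrite ?mulr1 ?mulr0.
rewrite (@fubini_tonelli _ _ _ _ R mu mu h' mh' h'0).
rewrite [RHS]integral_mkcond; apply: eq_integral => y _; rewrite patchE.
case: ifPn => yD; last first.
  by rewrite integral0_eq// => x _; rewrite /h'/= !indicE (negbTE yD) !mulr0.
rewrite [RHS]integral_mkcond; apply: eq_integral => x _; rewrite patchE.
by rewrite /h'/= !indicE yD mulr1; case: ifPn => xD; rewrite ?mulr1 ?mulr0.
Qed.

(** [ge0_substitution] when [F] maps [I] onto the interval [J]: by monotonicity the
    images of an exhaustion of [I] then exhaust [J]. *)
Lemma substitution_onto (I J : set R) (a_ b_ : nat -> R) (F f G : R -> R) :
  open I -> is_interval J ->
  I = \bigcup_n `[a_ n, b_ n]%classic ->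
  nonincreasing_seq a_ -> nondecreasing_seq b_ -> (forall n, a_ n < b_ n) ->
  {in I &, {homo F : x y / x < y}} ->
  (forall x, I x -> J (F x)) -> (forall y, J y -> exists2 x, I x & F x = y) ->
  {in I, forall x : R, is_derive x 1 F (f x)} ->
  {in I, continuous f} -> {in I, forall x, 0 <= f x} ->
  {in J, continuous G} -> {in J, forall x, 0 <= G x} ->
  (\int[mu]_(y in J) (G y)%:E = \int[mu]_(x in I) (G (F x) * f x)%:E)%E.
Proof.
move=> oI iJ IE an bn ab incF IJ JI; apply: (ge0_substitution oI IE) => //.
have aI n : I (a_ n) by rewrite IE; exists n => //=; rewrite in_itv/= lexx ltW.
have bI n : I (b_ n) by rewrite IE; exists n => //=; rewrite in_itv/= lexx ltW.
have leF x y : I x -> I y -> x <= y -> F x <= F y.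
  move=> xI yI; rewrite !le_eqVlt => /predU1P[->|xy]; first by rewrite eqxx.
  by rewrite (incF x y) ?inE// orbT.
apply/seteqP; split=> [y /JI[x]|y [n _ /=]].
  move=> xI <-; move: (xI); rewrite {1}IE => -[n _ /=].
  by rewrite in_itv/= => /andP[ax xb]; exists n => //=; rewrite in_itv/= !leF.
rewrite in_itv/= => /andP[ay yb].
by apply: (iJ _ _ (IJ _ (aI n)) (IJ _ (bI n))); rewrite ay yb.
Qed.

Lemma natr_bound (x : R) : exists n : nat, x <= n.+2%:R.
Proof.
exists (Num.truncn x); apply/ltW; apply: lt_trans (truncnS_gt x) _.
by rewrite ltr_nat.
Qed.

Lemma half_line_exhaustion :
  `]0%R, +oo[%classic = \bigcup_n `[n.+2%:R^-1, n.+2%:R]%classic :> set R.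
Proof.
apply/seteqP; split=> x.
  rewrite /= in_itv/= andbT => x0; have [n nx] := natr_bound (x + x^-1).
  exists n => //=; rewrite in_itv/=.
  have xV0 : 0 < x^-1 by rewrite invr_gt0.
  rewrite (le_trans _ nx) ?lerDl ?(ltW xV0)// andbT.
  rewrite -[leRHS]invrK lef_pV2 ?posrE//.
  by rewrite (le_trans _ nx)// lerDr ltW.
case=> n _; rewrite /= !in_itv/= andbT => /andP[nx _].
by rewrite (lt_le_trans _ nx)// invr_gt0.
Qed.

Lemma unit_interval_exhaustion :
  `]0%R, 1%R[%classic = \bigcup_n `[n.+3%:R^-1, 1 - n.+3%:R^-1]%classic :> set R.
Proof.
apply/seteqP; split=> x.
  rewrite /= in_itv/= => /andP[x0 x1].
  have [n nx] := natr_bound (x^-1 + (1 - x)^-1).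
  have y0 : 0 < 1 - x by rewrite subr_gt0.
  have xV0 : 0 < x^-1 by rewrite invr_gt0.
  have yV0 : 0 < (1 - x)^-1 by rewrite invr_gt0.
  have n23 : n.+2%:R <= n.+3%:R :> R by rewrite ler_nat.
  have nx1 : n.+3%:R^-1 <= x.
    by rewrite invf_ple ?posrE// (le_trans _ n23)// (le_trans _ nx)// lerDl ltW.
  have nx2 : n.+3%:R^-1 <= 1 - x.
    by rewrite invf_ple ?posrE// (le_trans _ n23)// (le_trans _ nx)// lerDr ltW.
  by exists n => //=; rewrite in_itv/= nx1 lerBrDr -lerBrDl.
case=> n _; rewrite /= !in_itv/= => /andP[nx xn].
by rewrite (lt_le_trans _ nx) ?invr_gt0//= (le_lt_trans xn)//.
Qed.

Let pos := `]0%R, +oo[%classic : set R.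

Let posE (x : R) : pos x = (0 < x) :> Prop.
Proof. by rewrite /pos /= in_itv/= andbT. Qed.

Lemma substitution_half_line (J : set R) (F f G : R -> R) :
  is_interval J -> (forall x y, 0 < x -> x < y -> F x < F y) ->
  (forall x, 0 < x -> J (F x)) -> (forall y, J y -> exists2 x, 0 < x & F x = y) ->
  (forall x : R, 0 < x -> is_derive x 1 F (f x)) ->
  (forall x, 0 < x -> {for x, continuous f}) -> (forall x, 0 < x -> 0 <= f x) ->
  {in J, continuous G} -> {in J, forall x, 0 <= G x} ->
  (\int[mu]_(y in J) (G y)%:E =
   \int[mu]_(x in `]0%R, +oo[) (G (F x) * f x)%:E)%E.
Proof.
move=> iJ incF IJ JI dF cf f0 cG G0.
have inpos x : x \in pos -> 0 < x by rewrite inE posE.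
apply: (@substitution_onto pos J (fun n => n.+2%:R^-1) (fun n => n.+2%:R) F f G)
.
- by rewrite /pos; exact: interval_open.
- exact: iJ.
- exact: half_line_exhaustion.
- by move=> m n mn; rewrite lef_pV2 ?posrE// ler_nat.
- by move=> m n mn; rewrite ler_nat.
- by move=> n; rewrite (@lt_trans _ _ 1)// ?invf_lt1// ltr1n.
- by move=> x y /inpos x0 _; exact: incF.
- by move=> x; rewrite posE; exact: IJ.
- by move=> y /JI[x x0 xy]; exists x => //; rewrite posE.
- by move=> x /inpos; exact: dF.
- by move=> x /inpos; exact: cf.
- by move=> x /inpos; exact: f0.
- exact: cG.
- exact: G0.
Qed.

Lemma substitution_scale (k : R) (G : R -> R) : 0 < k ->
  (forall x, 0 < x -> {for x, continuous G}) -> (forall x, 0 < x -> 0 <= G x) ->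
  (\int[mu]_(y in `]0%R, +oo[) (G y)%:E =
   \int[mu]_(x in `]0%R, +oo[) (G (k * x) * k)%:E)%E.
Proof.
move=> k0 cG G0.
have inpos x : x \in pos -> 0 < x by rewrite inE posE.
apply: (@substitution_half_line pos (fun x => k * x) (fun=> k)).
- exact: interval_is_interval.
- by move=> x y x0 xy; rewrite ltr_pM2l.
- by move=> x x0; rewrite posE mulr_gt0.
- move=> y; rewrite posE => y0; exists (y / k); first exact: divr_gt0.
  by rewrite mulrC divfK// gt_eqF.
- move=> x x0.
  have d : is_derive x 1 (fun x => k * x) _ :=
    @is_deriveM R R (cst k) id x 1 0 1 (is_derive_cst k x 1) (is_derive_id x 1).
  apply: (is_derive_eq d); rewrite -![_ *: _]/(_ * _) /cst/=; ring.
- by move=> x x0; exact: cvg_cst.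
- by move=> x _; exact: ltW.
- by move=> x /inpos; exact: cG.
- by move=> x /inpos; exact: G0.
Qed.

Lemma substitution_odds (G : R -> R) :
  (forall x, 0 < x -> {for x, continuous G}) -> (forall x, 0 < x -> 0 <= G x) ->
  (\int[mu]_(y in `]0%R, +oo[) (G y)%:E =
   \int[mu]_(u in `]0%R, 1%R[) (G (u / (1 - u)) * ((1 - u) ^+ 2)^-1)%:E)%E.
Proof.
move=> cG G0.
have inpos x : x \in pos -> 0 < x by rewrite inE posE.
pose I := `]0%R, 1%R[%classic : set R.
have inI x : x \in I -> 0 < x /\ 0 < 1 - x.
  by rewrite inE /I /= in_itv/= => /andP[x0 x1]; rewrite subr_gt0.
apply: (@substitution_onto I pos (fun n => n.+3%:R^-1) (fun n => 1 - n.+3%:R^-1)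
    (fun u => u / (1 - u)) (fun u => ((1 - u) ^+ 2)^-1) G).
- by rewrite /I; exact: interval_open.
- exact: interval_is_interval.
- exact: unit_interval_exhaustion.
- by move=> m n mn; rewrite lef_pV2 ?posrE// ler_nat.
- by move=> m n mn; rewrite lerD2l lerN2 lef_pV2 ?posrE// ler_nat.
- move=> n; rewrite ltrBrDr -mulr2n -[_ *+ 2]mulr_natl ltr_pdivrMr// mul1r.
  by rewrite ltr_nat.
- move=> x y /inI[x0 x1] /inI[y0 y1] xy.
  by rewrite ltr_pdivrMr// mulrAC ltr_pdivlMr//; nra.
- by move=> x; rewrite -inE => /inI[x0 x1]; rewrite posE divr_gt0.
- move=> y; rewrite posE => y0.
  have y10 : 0 < 1 + y by rewrite addr_gt0.
  exists (y / (1 + y)).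
    by rewrite /I/= in_itv/= divr_gt0// ltr_pdivrMr// mul1r /= ltrDr.
  by field; rewrite addrK oner_neq0 gt_eqF.
- move=> u /inI[u0 v0].
  have d1 : is_derive u 1 (fun u => 1 - u) (0 - 1).
    exact: (@is_deriveB R R R (cst 1) id u 1 0 1 _ _).
  have d2 := @is_deriveV R (fun u => 1 - u) u _ 1 (lt0r_neq0 v0) d1.
  have d3 : is_derive u 1 (fun u => u / (1 - u)) _ :=
    @is_deriveM R R id _ u 1 1 _ (is_derive_id u 1) d2.
  apply: (is_derive_eq d3); rewrite -![_ *: _]/(_ * _) /=; field.
  by rewrite gt_eqF.
- move=> u /inI[u0 v0].
  have nz : (1 - u) ^+ 2 != 0 by rewrite expf_neq0// gt_eqF.
  apply: (@continuousV R R (fun u => (1 - u) ^+ 2) u nz).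
  have c1 : {for u, continuous (fun u : R => 1 - u)}.
    by apply: (@continuousB R R R (cst 1) id); [exact: cvg_cst|exact: cvg_id].
  exact: (@continuousM R R (fun u => 1 - u) (fun u => 1 - u) u c1 c1).
- by move=> u /inI[u0 v0]; rewrite invr_ge0 exprn_ge0// ltW.
- by move=> x /inpos; exact: cG.
- by move=> x /inpos; exact: G0.
Qed.

End changes_of_variables.

Section gamma.
Variable R : realType.
Notation mu := (@lebesgue_measure R).

Definition gamma_integral (p : R) : \bar R :=
  (\int[mu]_(x in `]0%R, +oo[) (x `^ (p - 1) * expR (- x))%:E)%E.

Definition beta_integral (p q : R) : \bar R :=
  (\int[mu]_(u in `]0%R, 1%R[) (u `^ (p - 1) * (1 - u) `^ (q - 1))%:E)%E.

Lemma continuous_powR (a x : R) : 0 < x -> {for x, continuous (fun x => x `^ a)}.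
Proof. by move=> x0; exact: is_derive_continuous (is_derive1_powR a x0). Qed.

Lemma continuous_gamma (p x : R) : 0 < x ->
  {for x, continuous (fun x => x `^ (p - 1) * expR (- x))}.
Proof.
move=> x0; apply: (@continuousM R R (fun x => x `^ (p - 1)) (fun x => expR (- x))).
  exact: continuous_powR.
apply: (@continuous_comp R R R -%R expR x); last exact: continuous_expR.
exact: opp_continuous.
Qed.

Lemma measurable_gamma (p : R) :
  measurable_fun [set: R] (fun x => x `^ (p - 1) * expR (- x)).
Proof.
apply: measurable_funM; first exact: measurable_powR.
by apply: (measurableT_comp (@measurable_expR R)); exact: oppr_measurable.
Qed.

Lemma gamma_scale (p k : R) : 0 < k ->
  (\int[mu]_(x in `]0%R, +oo[) (x `^ (p - 1) * expR (- (k * x)))%:E =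
   (k `^ (- p))%:E * gamma_integral p)%E.
Proof.
move=> k0; rewrite /gamma_integral [in RHS](substitution_scale k0); first last.
- by move=> x _; rewrite mulr_ge0 ?powR_ge0 ?expR_ge0.
- by move=> x x0; exact: continuous_gamma.
rewrite -ge0_integralZl//; first last.
- by rewrite lee_fin powR_ge0.
- by move=> x _; rewrite lee_fin !mulr_ge0 ?powR_ge0 ?expR_ge0 ?ltW.
- apply/measurable_EFinP/measurable_funTS/measurable_funM => //.
  apply: (@measurableT_comp _ _ _ _ _ _ _ _ (fun x => k * x) (measurable_gamma p)).
  by apply: measurable_funM; [exact: measurable_cst|exact: measurable_id].
apply: eq_integral => x; rewrite inE /= in_itv/= andbT => x0.
rewrite -EFinM; congr EFin.
rewrite powRM ?(ltW k0) ?(ltW x0)//.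
have -> : k `^ (- p) = (k `^ (p - 1) * k)^-1.
  rewrite powRN -[in RHS](powRr1 (ltW k0)) -powRrM mul1r; congr _^-1.
  by rewrite -powRD ?(gt_eqF k0) ?implybT// subrK.
have kp0 : 0 < k `^ (p - 1) by exact: powR_gt0.
by field; rewrite !gt_eqF.
Qed.

Lemma gamma_integral_ge0 (p : R) : (0 <= gamma_integral p)%E.
Proof.
by apply: integral_ge0 => x _; rewrite lee_fin mulr_ge0 ?powR_ge0 ?expR_ge0.
Qed.

(** Scaling the inner variable by the outer one, [y = r x], turns the product into
    a double integral of [r ^ (q - 1) x ^ (p + q - 1) exp (- (1 + r) x)].
    Integrating over [x] first leaves the factor [Gamma (p + q)] and the integral
    of [r ^ (q - 1) (1 + r) ^ (- (p + q))], which [r = u / (1 - u)] maps to the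
    beta integral. *)
Lemma gamma_beta (p q : R) :
  (gamma_integral p * gamma_integral q = beta_integral q p * gamma_integral (p + q))%E.
Proof.
pose pos := `]0%R, +oo[%classic : set R.
have inpos x : x \in pos -> 0 < x by rewrite inE /pos/= in_itv/= andbT.
have mpos : measurable pos by exact: measurable_itv.
pose h (x r : R) := r `^ (q - 1) * (x `^ (p + q - 1) * expR (- ((1 + r) * x))).
have h0 x r : 0 <= h x r by rewrite !mulr_ge0 ?powR_ge0 ?expR_ge0.
have mh : measurable_fun [set: R * R] (fun z => h z.1 z.2).
  apply: measurable_funM.
    exact: (measurableT_comp (measurable_powR (q - 1)) measurable_snd).
  apply: measurable_funM.
    exact: (measurableT_comp (measurable_powR (p + q - 1)) measurable_fst).
  apply: (measurableT_comp (@measurable_expR R)).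
  apply: measurable_funN; apply: measurable_funM; last exact: measurable_fst.
  by apply: measurable_funD; [exact: measurable_cst|exact: measurable_snd].
transitivity (\int[mu]_(x in pos) \int[mu]_(r in pos) (h x r)%:E)%E.
  rewrite {1}/gamma_integral -ge0_integralZr//; first last.
  - exact: gamma_integral_ge0.
  - by move=> x _; rewrite lee_fin mulr_ge0 ?powR_ge0 ?expR_ge0.
  - apply/measurable_EFinP/measurable_funTS; exact: measurable_gamma.
  apply: eq_integral => x /inpos x0.
  transitivity ((x `^ (p + q - 1) * expR (- x))%:E *
      \int[mu]_(r in pos) (r `^ (q - 1) * expR (- (x * r)))%:E)%E.
    rewrite gamma_scale// muleA -EFinM; congr (_%:E * _)%E.
    rewrite mulrAC -powRD ?(gt_eqF x0) ?implybT//.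
    by congr (_ `^ _ * _); ring.
  rewrite -ge0_integralZl; first last.
  - by rewrite lee_fin mulr_ge0 ?powR_ge0 ?expR_ge0.
  - by move=> r _; rewrite lee_fin mulr_ge0 ?powR_ge0 ?expR_ge0.
  - apply/measurable_EFinP/measurable_funTS/measurable_funM.
      exact: measurable_powR.
    apply: (measurableT_comp (@measurable_expR R)).
    apply: measurable_funN; apply: measurable_funM; first exact: measurable_cst.
    exact: measurable_id.
  - exact: mpos.
  apply: eq_integral => r _; rewrite -EFinM; congr EFin.
  rewrite /h (_ : - ((1 + r) * x) = - x + - (x * r)); last by ring.
  by rewrite expRD; ring.
have bE : (\int[mu]_(r in pos) (r `^ (q - 1) * (1 + r) `^ (- (p + q)))%:E =
    beta_integral q p)%E.
  rewrite substitution_odds; first last.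
  - by move=> r _; rewrite mulr_ge0 ?powR_ge0.
  - move=> r r0.
    apply: (@continuousM R R (fun r => r `^ (q - 1)) (fun r => (1 + r) `^ (- (p + q)))).
      exact: continuous_powR.
    apply: (@continuous_comp R R R (fun r => 1 + r) (fun r => r `^ (- (p + q))) r).
      by apply: (@continuousD R R R (cst 1) id); [exact: cvg_cst|exact: cvg_id].
    by apply: continuous_powR; rewrite addr_gt0.
  apply: eq_integral => u; rewrite inE /= in_itv/= => /andP[u0 u1].
  have v0 : 0 < 1 - u by rewrite subr_gt0.
  congr EFin.
  rewrite (_ : 1 + u / (1 - u) = (1 - u)^-1); last by field; rewrite gt_eqF.
  have vV r : (1 - u)^-1 `^ r = (1 - u) `^ (- r).
    by rewrite -powR_inv1 ?ltW// -powRrM mulN1r.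
  have -> : ((1 - u) ^+ 2)^-1 = (1 - u) `^ (- 2).
    by rewrite powRN powR_mulrn ?ltW.
  rewrite powRM ?invr_ge0 ?(ltW u0) ?(ltW v0)// !vV -!mulrA; congr (_ * _).
  rewrite -!powRD ?(gt_eqF v0) ?implybT//; congr (_ `^ _).
  by ring.
rewrite (tonelli_itv mpos mpos mh h0).
transitivity (\int[mu]_(r in pos)
    ((r `^ (q - 1) * (1 + r) `^ (- (p + q)))%:E * gamma_integral (p + q)))%E.
  apply: eq_integral => r /inpos r0.
  have r10 : 0 < 1 + r by rewrite addr_gt0.
  rewrite [in RHS]EFinM -muleA -(gamma_scale (p + q) r10).
  rewrite -ge0_integralZl; first last.
  - by rewrite lee_fin powR_ge0.
  - by move=> x _; rewrite lee_fin mulr_ge0 ?powR_ge0 ?expR_ge0.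
  - apply/measurable_EFinP/measurable_funTS/measurable_funM.
      exact: measurable_powR.
    apply: (measurableT_comp (@measurable_expR R)).
    apply: measurable_funN; apply: measurable_funM; first exact: measurable_cst.
    exact: measurable_id.
  - exact: mpos.
  by apply: eq_integral => x _; rewrite -EFinM.
rewrite ge0_integralZr; first last.
- exact: gamma_integral_ge0.
- by move=> r _; rewrite lee_fin mulr_ge0 ?powR_ge0.
- apply/measurable_EFinP/measurable_funTS/measurable_funM.
    exact: measurable_powR.
  apply: (measurableT_comp (measurable_powR (- (p + q)))).
  by apply: measurable_funD; [exact: measurable_cst|exact: measurable_id].
- exact: mpos.
by rewrite bE.
Qed.

End gamma.

Section gamma_positive.
Variable R : realType.
Notation mu := (@lebesgue_measure R).

(** The integrand is at most a multiple of the derivative of the bounded function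
    [1 - (1 + x `^ p)^-1], which has the same behaviour at [0]: the square of
    [1 + x `^ p] grows more slowly than the exponential. *)
Lemma gamma_integral_lty (p : R) : 0 < p -> (gamma_integral p < +oo)%E.
Proof.
move=> p0.
pose F x : R := 1 - (1 + x `^ p)^-1.
pose f x : R := p * x `^ (p - 1) * ((1 + x `^ p) ^+ 2)^-1.
have q0 x : 0 < 1 + x `^ p by rewrite ltr_pwDl ?powR_ge0.
have f0 x : 0 <= f x.
  by rewrite /f !mulr_ge0 ?powR_ge0 ?(ltW p0)// invr_ge0 exprn_ge0 ?ltW.
have f1 : (\int[mu]_(x in `]0%R, +oo[) (f x)%:E = 1)%E.
  transitivity (\int[mu]_(x in `]0%R, +oo[) (cst 1 (F x) * f x)%:E)%E.
    by apply: eq_integral => x _; rewrite /= mul1r.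
  transitivity (\int[mu]_(y in `]0%R, 1%R[) (cst 1 y)%:E)%E; last first.
    transitivity (\int[mu]_(y in `]0%R, 1%R[) cst 1%E y)%E.
      by apply: eq_integral => y _.
    rewrite integral_cst; last exact: measurable_itv.
    by rewrite /= lebesgue_measure_itv/= lte_fin ltr01 mul1e sube0.
  apply/esym/substitution_half_line.
  - exact: interval_is_interval.
  - move=> x y x0 xy; rewrite /F ltrD2l ltrN2 ltf_pV2 ?posrE// ltrD2l.
    by apply: gt0_ltr_powR; rewrite ?nnegrE ?ltW ?(lt_trans x0 xy).
  - move=> x x0; rewrite /= in_itv/= /F subr_gt0 invf_lt1// ltrDl powR_gt0//=.
    by rewrite ltrBlDr ltrDl invr_gt0.
  - move=> y; rewrite /= in_itv/= => /andP[y0 y1].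
    have y1' : 0 < 1 - y by rewrite subr_gt0.
    exists ((y / (1 - y)) `^ p^-1); first by rewrite powR_gt0 ?divr_gt0.
    rewrite /F -powRrM mulVf ?gt_eqF// powRr1 ?divr_ge0 ?ltW//.
    by field; rewrite subrK oner_neq0 gt_eqF.
  - move=> x x0.
    have d1 : is_derive x 1 (fun x => 1 + x `^ p) (0 + p * x `^ (p - 1)).
      exact: (@is_deriveD R R R (cst 1) _ x 1 0 _ _ (is_derive1_powR p x0)).
    have nz : 1 + x `^ p != 0 by rewrite gt_eqF.
    have d2 := @is_deriveV R (fun x => 1 + x `^ p) x _ 1 nz d1.
    have d3 : is_derive x 1 F _ :=
      @is_deriveB R R R (cst 1) _ x 1 0 _ (is_derive_cst (1 : R) (x : R) 1) d2.
    apply: (is_derive_eq d3); rewrite -![_ *: _]/(_ * _) /f; ring.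
  - move=> x x0.
    have c1 : {for x, continuous (fun x : R => 1 + x `^ p)}.
      apply: (@continuousD R R R (cst 1)); first exact: cvg_cst.
      exact: continuous_powR.
    have nz : (1 + x `^ p) ^+ 2 != 0 by rewrite expf_neq0// gt_eqF.
    apply: (@continuousM R R (fun x => p * x `^ (p - 1))
      (fun x => ((1 + x `^ p) ^+ 2)^-1)).
      apply: (@continuousM R R (cst p)); first exact: cvg_cst.
      exact: continuous_powR.
    apply: (@continuousV R R (fun x => (1 + x `^ p) ^+ 2) x nz).
    exact: (@continuousM R R _ _ x c1 c1).
  - by move=> x x0.
  - by move=> x _; exact: cvg_cst.
  - by move=> x _; exact: ler01.
(* from [x / (2 * p) <= expR (x / (2 * p))], raised to the power [p] *)
pose C := 1 + (2 * p) `^ p.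
have C0 : 0 < C by rewrite ltr_pwDl ?powR_ge0.
have bound x : 0 < x -> x `^ (p - 1) * expR (- x) <= C ^+ 2 / p * f x.
  move=> x0; rewrite /f.
  have e2 : 1 <= expR (x / 2).
    by rewrite (le_trans _ (expR_ge1Dx _))// lerDl divr_ge0 ?ltW.
  have q_le : 1 + x `^ p <= C * expR (x / 2).
    rewrite mulrDl mul1r lerD//.
    have pp0 : 0 < 2 * p by rewrite mulr_gt0.
    have a0 : 0 <= x / (2 * p) by rewrite divr_ge0 ?ltW.
    have {1}-> : x = (2 * p) * (x / (2 * p)) by field; rewrite gt_eqF.
    rewrite powRM ?(ltW pp0)// ler_wpM2l ?powR_ge0//.
    have -> : x / 2 = x / (2 * p) * p by field; rewrite gt_eqF.
    rewrite expRM; apply: ge0_ler_powR.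
    - exact: ltW.
    - by rewrite nnegrE.
    - by rewrite nnegrE expR_ge0.
    - by rewrite (le_trans _ (expR_ge1Dx _))// lerDr.
  have q_sq : (1 + x `^ p) ^+ 2 <= C ^+ 2 * expR x.
    have -> : expR x = expR (x / 2) ^+ 2 by rewrite expr2 -expRD; congr expR; field.
    rewrite -exprMn lerXn2r ?nnegrE ?(ltW (q0 x))//.
    by rewrite mulr_ge0 ?expR_ge0 ?ltW.
  rewrite expRN (_ : C ^+ 2 / p * _ = x `^ (p - 1) * (C ^+ 2 / (1 + x `^ p) ^+ 2));
    last by field; rewrite !gt_eqF.
  rewrite ler_wpM2l ?powR_ge0// ler_pdivlMr ?exprn_gt0//.
  by rewrite mulrC ler_pdivrMr ?expR_gt0.
apply: (@le_lt_trans _ _ (C ^+ 2 / p)%:E); last exact: ltry.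
have mf : measurable_fun [set: R] f.
  apply: measurable_funM.
    by apply: measurable_funM; [exact: measurable_cst|exact: measurable_powR].
  apply: (measurableT_comp (@measurable_invr R)); apply: measurable_funX.
  by apply: measurable_funD; [exact: measurable_cst|exact: measurable_powR].
rewrite -[leRHS]mule1 -f1 -ge0_integralZl; first last.
- by rewrite lee_fin divr_ge0 ?sqr_ge0 ?ltW.
- by move=> x _; rewrite lee_fin.
- by apply/measurable_EFinP/measurable_funTS.
- exact: measurable_itv.
apply: ge0_le_integral => //.
- by move=> x _; rewrite lee_fin mulr_ge0 ?powR_ge0 ?expR_ge0.
- by apply/measurable_EFinP/measurable_funTS; exact: measurable_gamma.
- apply/measurable_EFinP/measurable_funTS.
  by apply: measurable_funM; [exact: measurable_cst|exact: mf].
- by move=> x; rewrite /= in_itv/= andbT => x0; rewrite -EFinM lee_fin bound.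
Qed.

(** On ]1, 2[ the integrand is at least [expR (- 2) / 2], since
    [x `^ (p - 1) >= x^-1] there. *)
Lemma gamma_integral_gt0 (p : R) : 0 < p -> (0 < gamma_integral p)%E.
Proof.
move=> p0.
have c0 : 0 < expR (- 2) / 2 :> R by rewrite divr_gt0 ?expR_gt0.
apply: (@lt_le_trans _ _ (\int[mu]_(x in `]1%R, 2%R[) (cst (expR (- 2) / 2)%:E x))%E).
  rewrite integral_cst; last exact: measurable_itv.
  rewrite /= lebesgue_measure_itv/= lte_fin ltr1n -EFinB -EFinM lte_fin.
  by rewrite mulr_gt0// subr_gt0 ltr1n.
apply: (@le_trans _ _
  (\int[mu]_(x in `]1%R, 2%R[) (x `^ (p - 1) * expR (- x))%:E)%E).
  apply: ge0_le_integral.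
  - exact: measurable_itv.
  - by move=> x _; rewrite lee_fin ltW.
  - exact: measurable_cst.
  - by apply/measurable_EFinP/measurable_funTS; exact: measurable_gamma.
  move=> x; rewrite /= in_itv/= => /andP[x1 x2]; rewrite lee_fin mulrC.
  apply: ler_pM; rewrite ?expR_ge0 ?invr_ge0//; last by rewrite ler_expR lerN2 ltW.
  apply: (@le_trans _ _ (x `^ (-1))); last first.
    by rewrite ler_powR ?(ltW x1)// lerBrDl subrr ltW.
  have x0 : 0 < x by rewrite (lt_trans ltr01).
  by rewrite powR_inv1 ?(ltW x0)// lef_pV2 ?posrE// ltW.
apply: ge0_subset_integral.
- exact: measurable_itv.
- exact: measurable_itv.
- by apply/measurable_EFinP/measurable_funTS; exact: measurable_gamma.
- by move=> x _; rewrite lee_fin mulr_ge0 ?powR_ge0 ?expR_ge0.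
- move=> x; rewrite /= !in_itv/= andbT => /andP[x1 _].
  by rewrite (lt_trans ltr01).
Qed.
End gamma_positive.

(** * From the complex functions to real integrals *)

Section bridge.
Variable R : realType.
Notation mu := (@lebesgue_measure R).

Lemma cpow_real (x w : R) : 0 < x -> cpow x%:C w%:C = (x `^ w)%:C.
Proof.
move=> x0; rewrite /cpow /clog /carg /cmod /= expr0n/= addr0 sqrtr_sqr.
rewrite ger0_norm ?(ltW x0)// divff ?gt_eqF// acos1 lexx.
rewrite /cexp /= !mulr0 !mul0r subr0 addr0 cos0 sin0 mulr1 mulr0.
by rewrite /powR gt_eqF.
Qed.

Lemma cintegral_real (D : set R) (f : R -> R[i]) (g : R -> R) :
  (forall u, D u -> f u = (g u)%:C) ->
  cintegral D f = (fine (\int[mu]_(u in D) (g u)%:E)%E)%:C.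
Proof.
move=> fg; rewrite /cintegral; congr (_ +i* _).
  by rewrite /Rintegral; congr fine; apply: eq_integral => u /[!inE] /fg ->.
rewrite /Rintegral integral0_eq// => u /fg -> //.
Qed.

Lemma Gamma_real (p : R) : Gamma p%:C = (fine (gamma_integral p))%:C.
Proof.
apply: cintegral_real => u; rewrite /= in_itv/= andbT => u0.
by rewrite -[1]/(1%:C) -rmorphB/= cpow_real// -rmorphM.
Qed.

(** Also for an infinite [x]: both sides vanish then. *)
Lemma fine_mulEFin (x : \bar R) (k : R) : fine (x * k%:E)%E = fine x * k.
Proof.
case: x => [x| |] //=; rewrite mul0r.
- have [k0|k0|->] := ltgtP k 0; last by rewrite mule0.
  + by rewrite lt0_mulye// lte_fin.
  + by rewrite gt0_mulye// lte_fin.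
- have [k0|k0|->] := ltgtP k 0; last by rewrite mule0.
  + by rewrite lt0_mulNye// lte_fin.
  + by rewrite gt0_mulNye// lte_fin.
Qed.

(** Finiteness of [b] is a consequence: [fine] vanishes at infinity, and then so
    would [fine x * fine y]. *)
Lemma fine_ratio (x y z b : \bar R) :
  x \is a fin_num -> y \is a fin_num -> z \is a fin_num ->
  fine x != 0 -> fine y != 0 -> fine z != 0 -> (x * y = b * z)%E ->
  fine z / (fine y * fine x) = (fine b)^-1.
Proof.
move=> + + + + + + /(congr1 fine).
case: x => // x _; case: y => // y _; case: z => // z _ /= x0 y0 z0.
rewrite fine_mulEFin => bE.
have b0 : fine b != 0.
  by apply: contra_neq (mulf_neq0 x0 y0) => b0; rewrite bE b0 mul0r.
by rewrite [y * x]mulrC bE; field; rewrite z0 b0.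
Qed.

(** The integral in the definition of [lauricellaFD] for three variables, with
    real parameters.  With values in the extended reals, the identities below
    hold whether or not the integrals converge. *)
Definition euler_integral (A b1 b2 b3 c x1 x2 x3 : R) : \bar R :=
  (\int[mu]_(u in `]0%R, 1%R[) (u `^ (A - 1) * (1 - u) `^ (c - A - 1) *
     ((1 - x1 * u) `^ (- b1) * ((1 - x2 * u) `^ (- b2) *
       (1 - x3 * u) `^ (- b3))))%:E)%E.

Lemma one_sub_mul_gt0 (x u : R) : x < 1 -> 0 < u -> u < 1 -> 0 < 1 - x * u.
Proof.
move=> x1 u0 u1; have -> : 1 - x * u = (1 - u) + (1 - x) * u by ring.
by rewrite addr_gt0 ?mulr_gt0 ?subr_gt0.
Qed.

Lemma fine_gamma_neq0 (p : R) : 0 < p -> fine (gamma_integral p) != 0.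
Proof.
move=> p0; rewrite gt_eqF// fine_gt0// gamma_integral_gt0//.
by rewrite gamma_integral_lty.
Qed.

(** The three Gamma factors combine into a single beta integral. *)
Lemma lauricellaFD_real (A b1 b2 b3 c x1 x2 x3 : R) :
  0 < A -> A < c -> x1 < 1 -> x2 < 1 -> x3 < 1 ->
  lauricellaFD A%:C [tuple b1%:C; b2%:C; b3%:C] c%:C [tuple x1%:C; x2%:C; x3%:C]
  = (fine (euler_integral A b1 b2 b3 c x1 x2 x3) /
     fine (beta_integral A (c - A)))%:C.
Proof.
move=> A0 Ac x11 x21 x31; have cA0 : 0 < c - A by rewrite subr_gt0.
have c0 : 0 < c by rewrite (lt_trans A0).
rewrite /lauricellaFD -rmorphB/= !Gamma_real.
rewrite (@cintegral_real _ _ (fun u => u `^ (A - 1) * (1 - u) `^ (c - A - 1) *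
     ((1 - x1 * u) `^ (- b1) * ((1 - x2 * u) `^ (- b2) *
       (1 - x3 * u) `^ (- b3))))); last first.
  move=> u; rewrite /= in_itv/= => /andP[u0 u1].
  rewrite !big_ord_recl big_ord0 /tnth/= mulr1.
  rewrite -[1]/(1%:C) -!rmorphM/= -!rmorphB/= -!rmorphN/=.
  by rewrite !cpow_real ?one_sub_mul_gt0 ?subr_gt0// -!rmorphM.
rewrite -!rmorphM/= -fmorphV/= -!rmorphM/=; congr (_%:C).
rewrite -/(euler_integral _ _ _ _ _ _ _ _) mulrC; congr (_ * _).
have fin (r : R) : 0 < r -> gamma_integral r \is a fin_num.
  by move=> r0; rewrite ge0_fin_numE ?gamma_integral_lty// gamma_integral_ge0.
apply: (@fine_ratio (gamma_integral (c - A))).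
- exact: fin.
- exact: fin.
- exact: fin.
- exact: fine_gamma_neq0.
- exact: fine_gamma_neq0.
- exact: fine_gamma_neq0.
- by rewrite gamma_beta subrK.
Qed.

(* identities between powers of positive numbers become identities between
   linear forms once every number is written as an exponential *)
Let expE : (forall a b : R, expR a * expR b = expR (a + b)) *
  (forall a : R, (expR a)^-1 = expR (- a)) *
  (forall a r : R, expR a `^ r = expR (a * r)) *
  (forall a : R, expR a ^+ 2 = expR (2 * a)) *
  (forall a : R, Num.sqrt (expR a) = expR (a / 2)).
Proof.
do ![split].
- by move=> a b; rewrite expRD.
- by move=> a; rewrite expRN.
- by move=> a r; rewrite expRM.
- by move=> a; rewrite expRM_natl.
- by move=> a; rewrite expRM powR12_sqrt ?expR_ge0.
Qed.

Let expR_ex (x : R) : 0 < x -> exists a, x = expR a.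
Proof. by move=> x0; exists (ln x); rewrite lnK. Qed.

Lemma left_integrandE (s c u v d1 d2 d3 : R) : 0 < c -> 0 < u -> 0 < v ->
  0 < d1 -> 0 < d2 -> 0 < d3 ->
  (c * (u ^+ 2 * v ^+ 2 / (d1 * d2 * d3))) `^ s * (u * v)^-1 =
  u `^ (2 * s - 1) * v `^ (2 * s - 1) *
    (d1 `^ (- s) * (d2 `^ (- s) * d3 `^ (- s))) * c `^ s.
Proof.
move=> /expR_ex[lc ->] /expR_ex[lu ->] /expR_ex[lv ->].
move=> /expR_ex[l1 ->] /expR_ex[l2 ->] /expR_ex[l3 ->].
by rewrite !expE; congr expR; ring.
Qed.

Lemma right_integrandE (s v w d b1 b2 : R) : 0 < v -> 0 < w -> 0 < d ->
  0 < b1 -> 0 < b2 ->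
  (v * w * d / (b1 * b2)) `^ s * (v * Num.sqrt (w * d))^-1 =
  v `^ (s - 1) * w `^ (s - 1 / 2) *
    (d `^ (s - 1 / 2) * (b1 `^ (- s) * b2 `^ (- s))).
Proof.
move=> /expR_ex[lv ->] /expR_ex[lw ->] /expR_ex[ld ->].
move=> /expR_ex[l1 ->] /expR_ex[l2 ->].
by rewrite !expE; congr expR; field.
Qed.

(** [lauricella_integral_transform] for the integrands of the Lauricella function.
    On the left [c - A = A], and on the right the exponents of [1 - v] and
    [1 - A v] agree; these coincidences make both integrands [s]-th powers times
    a density that does not depend on [s]. *)
Lemma euler_integral_transform (s e1 e2 e3 p A B1 B2 : R) :
  0 < s -> 0 < e1 -> 0 < e2 -> 0 < e3 -> 0 < p -> p ^+ 2 = e1 * e2 * e3 ->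
  let k0 := e1 + e2 * e3 in let k1 := e2 + e1 * e3 in let k2 := e3 + e1 * e2 in
  let c := 2 * p + k0 in
  c * A = k0 - 2 * p -> c * B1 = k0 - k1 -> c * B2 = k0 - k2 ->
  (euler_integral (2 * s) s s s (4 * s) (1 - e1) (1 - e2) (1 - e3) * (c `^ s)%:E =
   euler_integral s (1 / 2 - s) s s (2 * s + 1 / 2) A B1 B2)%E.
Proof.
move=> s0 e10 e20 e30 p0 pP k0 k1 k2 c cA cB1 cB2.
have k00 : 0 < k0 by rewrite /k0; positivity.
have k10 : 0 < k1 by rewrite /k1; positivity.
have k20 : 0 < k2 by rewrite /k2; positivity.
have c0 : 0 < c by rewrite /c; clearbody k0; positivity.
have solve x y : c * x = y -> x = y / c.
  by move=> <-; rewrite mulrC mulKf// gt_eqF.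
have lt1 x : c * x < c -> x < 1 by rewrite gtr_pMr.
have A1 : A < 1 by apply: lt1; rewrite cA /c; lra.
have B11 : B1 < 1 by apply: lt1; rewrite cB1 /c; lra.
have B21 : B2 < 1 by apply: lt1; rewrite cB2 /c; lra.
rewrite /euler_integral -ge0_integralZr; first last.
- by rewrite lee_fin powR_ge0.
- by move=> u _; rewrite lee_fin !mulr_ge0 ?powR_ge0.
- apply/measurable_EFinP/measurable_funTS.
  have m (x b : R) : measurable_fun [set: R] (fun u => (1 - x * u) `^ b).
    apply: (measurableT_comp (measurable_powR b)).
    apply: measurable_funB; first exact: measurable_cst.
    by apply: measurable_funM; [exact: measurable_cst|exact: measurable_id].
  have m1 (b : R) : measurable_fun [set: R] (fun u => (1 - u) `^ b).
    apply: (measurableT_comp (measurable_powR b)).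
    by apply: measurable_funB; [exact: measurable_cst|exact: measurable_id].
  apply: measurable_funM; last first.
    apply: measurable_funM; first exact: m.
    by apply: measurable_funM; exact: m.
  by apply: measurable_funM; [exact: measurable_powR|exact: m1].
- exact: measurable_itv.
have T := lauricella_integral_transform e10 e20 e30 p0 pP s0.
rewrite /= in T.
transitivity (\int[mu]_(u in `]0%R, 1%R[) ((c * (u ^+ 2 * (1 - u) ^+ 2 /
  ((1 - u + e1 * u) * (1 - u + e2 * u) * (1 - u + e3 * u)))) `^ s *
    (u * (1 - u))^-1)%:E)%E.
  apply: eq_integral => u; rewrite inE /= in_itv/= => /andP[u0 u1].
  have v0 : 0 < 1 - u by rewrite subr_gt0.
  rewrite left_integrandE//; try by positivity.
  rewrite -EFinM; congr (_%:E); congr (_ * _ * _).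
    by congr (_ `^ _ * _ `^ _); ring.
  by congr (_ `^ _ * (_ `^ _ * _ `^ _)); ring.
rewrite T.
apply: eq_integral => v; rewrite inE /= in_itv/= => /andP[v0 v1].
have w0 : 0 < 1 - v by rewrite subr_gt0.
rewrite -/k0 -/k1 -/k2 -/c -(solve _ _ cA) -(solve _ _ cB1) -(solve _ _ cB2).
rewrite right_integrandE ?one_sub_mul_gt0//.
congr (_%:E); congr (_ * _ * (_ * _)).
- by congr (_ `^ _); field.
- by congr (_ `^ _); ring.
Qed.

End bridge.

Section special_values.
Variable R : realType.

Lemma euler_integral0 (A b1 b2 b3 c : R) :
  euler_integral A b1 b2 b3 c 0 0 0 = beta_integral A (c - A).
Proof.
by apply: eq_integral => u _; rewrite !mul0r !subr0 !powR1 !mulr1.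
Qed.

Lemma euler_integral_swap (A b1 b c x1 x2 x3 : R) :
  euler_integral A b1 b b c x1 x2 x3 = euler_integral A b1 b b c x1 x3 x2.
Proof.
by apply: eq_integral => u _; rewrite [X in _ * (_ * X)]mulrC.
Qed.

(** The case [e1 = e2 = e3 = 1], where the three variables of both Lauricella
    functions vanish. *)
Lemma beta_integral_transform (s : R) : 0 < s ->
  (beta_integral (2 * s) (4 * s - 2 * s) * (4 `^ s)%:E =
   beta_integral s (2 * s + 1 / 2 - s))%E.
Proof.
move=> s0; rewrite -(euler_integral0 _ s s s) -(euler_integral0 _ (1 / 2 - s) s s).
have := @euler_integral_transform R s 1 1 1 1 0 0 0; rewrite /=.
have -> : 2 * 1 + (1 + 1 * 1) = 4 :> R by ring.
rewrite /= !subrr; apply => //; by [rewrite expr1n !mulr1|ring].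
Qed.
End special_values.

Unset Implicit Arguments.

Theorem theorem5p1 (R : realType) (t alpha1 alpha2 a beta1 beta2 : R)
  (ht : t < - 1)
  (halpha12 : alpha1 < alpha2)
  (halpha2 : alpha2 < - ((1 + t) ^+ 2 / 2))
  (ha : a < 1)
  (hbeta1 : beta1 =
    - (alpha1 * (alpha1 + 2 * t) / (2 * alpha1 + (1 + t) ^+ 2)))
  (hbeta2 : beta2 =
    - (alpha2 * (alpha2 + 2 * t) / (2 * alpha2 + (1 + t) ^+ 2))) :
  lauricellaFD (2 - 2 * a)%:C
    [tuple (1 - a)%:C; (1 - a)%:C; (1 - a)%:C]
    (4 - 4 * a)%:C
    [tuple (2 * (beta2 - beta1) * t / (alpha2 * beta1 - alpha1 * beta2))%:C;
           (- (2 * t / alpha1))%:C; (- (2 * t / alpha2))%:C]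
  =
  ((t ^+ 2 * (alpha1 + 2 * t) * (alpha2 + 2 * t)
     / (alpha1 * alpha2 * (1 - t) ^+ 2)) `^ (a - 1))%:C *
  lauricellaFD (1 - a)%:C
    [tuple (a - 1 / 2)%:C; (1 - a)%:C; (1 - a)%:C]
    (5 / 2 - 2 * a)%:C
    [tuple (1 / t ^+ 2)%:C; (1 / beta1)%:C; (1 / beta2)%:C].
Proof.
pose s := 1 - a; have s0 : 0 < s by rewrite subr_gt0.
have s24 : 2 * s < 4 * s by lra.
have s12 : s < 2 * s + 1 / 2 by lra.
have subD_lt (k m d : R) : 0 < m -> 0 < d -> k - d < m + k by move=> *; lra.
have -> : 2 - 2 * a = 2 * s by rewrite /s; ring.
have -> : 4 - 4 * a = 4 * s by rewrite /s; ring.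
have -> : a - 1 / 2 = 1 / 2 - s by rewrite /s; field.
have -> : 5 / 2 - 2 * a = 2 * s + 1 / 2 by rewrite /s; field.
have -> : a - 1 = - s by rewrite /s; ring.
rewrite -/s.
have t0 : t < 0 by lra.
have sq0 : 0 <= (1 + t) ^+ 2 by exact: sqr_ge0.
have al20 : alpha2 < 0 by lra.
have al10 : alpha1 < 0 by lra.
have D1 : 2 * alpha1 + (1 + t) ^+ 2 < 0 by lra.
have D2 : 2 * alpha2 + (1 + t) ^+ 2 < 0 by lra.
(* the parameters [1 - x_i] of the left-hand side; [e1] is the one given by
   [x1], in the form that makes [e1 * e2 * e3] a square *)
pose e2 := (alpha1 + 2 * t) / alpha1; pose e3 := (alpha2 + 2 * t) / alpha2.
pose q := (1 + t) / (t - 1).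
have e20 : 0 < e2 by rewrite /e2 ltr_ndivlMr// mul0r; lra.
have e30 : 0 < e3 by rewrite /e3 ltr_ndivlMr// mul0r; lra.
have q0 : 0 < q by rewrite /q ltr_ndivlMr ?mul0r; lra.
pose e1 := q ^+ 2 * e2 * e3; pose p := q * e2 * e3.
have e10 : 0 < e1 by rewrite /e1; clearbody q e2 e3; positivity.
have p0 : 0 < p by rewrite /p; clearbody q e2 e3; positivity.
have pP : p ^+ 2 = e1 * e2 * e3 by rewrite /p /e1; ring.
have nz1 : alpha1 != 0 by rewrite lt_eqF.
have nz2 : alpha2 != 0 by rewrite lt_eqF.
have nzt : t != 0 by rewrite lt_eqF.
have nzt1 : t - 1 != 0 by rewrite lt_eqF//; lra.
have nz1t : 1 - t != 0 by rewrite gt_eqF//; lra.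
have nzD1 : 2 * alpha1 + (1 + t) ^+ 2 != 0 by rewrite lt_eqF.
have nzD2 : 2 * alpha2 + (1 + t) ^+ 2 != 0 by rewrite lt_eqF.
have nzs1 : alpha1 + 2 * t != 0 by rewrite lt_eqF//; lra.
have nzs2 : alpha2 + 2 * t != 0 by rewrite lt_eqF//; lra.
have nz12 : alpha1 - alpha2 != 0 by rewrite lt_eqF// subr_lt0.
have nz := (nz1, (nz2, (nzt, (nzt1, (nz1t, (nzD1, (nzD2, (nzs1, (nzs2, nz12))))))))).
pose K := t ^+ 2 * (alpha1 + 2 * t) * (alpha2 + 2 * t)
     / (alpha1 * alpha2 * (1 - t) ^+ 2).
have cE : 2 * p + (e1 + e2 * e3) = 4 * K.
  by rewrite /p /e1 /e2 /e3 /q /K; field; rewrite nz1t nz1 nz2.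
have K0 : 0 < K.
  suff : 0 < 4 * K by rewrite pmulr_rgt0.
  by rewrite -cE; clearbody e1 p e2 e3; positivity.
have x1E : 2 * (beta2 - beta1) * t / (alpha2 * beta1 - alpha1 * beta2) = 1 - e1.
  have -> : alpha2 * beta1 - alpha1 * beta2 =
      - (alpha1 * alpha2 * (alpha1 - alpha2) * (1 - t) ^+ 2) /
        ((2 * alpha1 + (1 + t) ^+ 2) * (2 * alpha2 + (1 + t) ^+ 2)).
    by rewrite hbeta1 hbeta2; field; rewrite nzD1 nzD2.
  rewrite hbeta1 hbeta2 /e1 /e2 /e3 /q; field.
  by rewrite nz1 nz2 nzt1 nz1t nz12 nzD1 nzD2.
have x2E : - (2 * t / alpha1) = 1 - e2 by rewrite /e2; field.
have x3E : - (2 * t / alpha2) = 1 - e3 by rewrite /e3; field.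
have cA : 4 * K * (1 / t ^+ 2) = (e1 + e2 * e3) - 2 * p.
  by rewrite /p /e1 /e2 /e3 /q /K; field; rewrite ?nz.
have cB1 : 4 * K * (1 / beta2) = (e1 + e2 * e3) - (e2 + e1 * e3).
  rewrite hbeta2 /e1 /e2 /e3 /q /K; field.
  by rewrite ?nz.
have cB2 : 4 * K * (1 / beta1) = (e1 + e2 * e3) - (e3 + e1 * e2).
  rewrite hbeta1 /e1 /e2 /e3 /q /K; field.
  by rewrite ?nz.
have lt1 (y : R) : 0 < y -> 1 - y < 1 by move=> y0; rewrite ltrBlDr ltrDl.
have lt1' (x : R) : 4 * K * x < 4 * K -> x < 1 by rewrite gtr_pMr// mulr_gt0.
have k10 : 0 < e2 + e1 * e3 by clearbody e1 e2 e3; positivity.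
have k20 : 0 < e3 + e1 * e2 by clearbody e1 e2 e3; positivity.
have A1 : 1 / t ^+ 2 < 1 by apply: lt1'; rewrite cA -cE subD_lt// mulr_gt0.
have B1 : 1 / beta1 < 1 by apply: lt1'; rewrite cB2 -cE subD_lt// mulr_gt0.
have B2 : 1 / beta2 < 1 by apply: lt1'; rewrite cB1 -cE subD_lt// mulr_gt0.
rewrite x1E x2E x3E -/K.
rewrite (lauricellaFD_real s s s _ s24 (lt1 _ e10) (lt1 _ e20) (lt1 _ e30));
  last by rewrite mulr_gt0.
rewrite (lauricellaFD_real (1 / 2 - s) s s s0 s12 A1 B1 B2).
rewrite -rmorphM; congr (_%:C).
rewrite -cE in cA cB1 cB2.
have T := euler_integral_transform s0 e10 e20 e30 p0 pP cA cB1 cB2.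
rewrite [in RHS]euler_integral_swap -T -(beta_integral_transform s0) cE !fine_mulEFin.
rewrite powRM ?(ltW K0)// powRN.
have K0' : K `^ s != 0 by rewrite gt_eqF// powR_gt0.
have f0 : 4 `^ s != 0 :> R by rewrite gt_eqF// powR_gt0.
rewrite [(_ * 4 `^ s)^-1]invfM; move: (fine (beta_integral _ _))^-1 => b.
by field; rewrite K0' f0.
Qed.
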